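(* Let $\Gamma$ be a countable discrete group and let $X$ be a compact $\Gamma$-space (not necessarily minimal). Suppose that the stability system $\mathcal{S}_X$ is a URS of $\Gamma$. Then $\mathcal{S}_{\tilde X}$ contains a unique URS $\mathcal{A}_X$. Moreover, $\mathcal{A}_X$ is the largest amenable URS dominated by $\mathcal{S}_X$: namely, $\mathcal{A}_X$ is an amenable URS with $\mathcal{A}_X\preccurlyeq\mathcal{S}_X$, and for every amenable URS $\mathcal{U}$ such that $\mathcal{U}\preccurlyeq\mathcal{S}_X$, we have $\mathcal{U}\preccurlyeq\mathcal{A}_X$.
   Context: A compact $\Gamma$-space is a (nonempty) compact Hausdorff space with an action of $\Gamma$ by homeomorphisms. Stabilizers: $\Gamma_x=\{t\in\Gamma: tx=x\}$, and $\Gamma_x^\circ$ is the subgroup of elements of $\Gamma$ that act as the identity on a neighborhood of $x$. $\mathrm{Sub}(\Gamma)$ is the set of all subgroups of $\Gamma$ with the Chabauty topology (relative topology of the product topology on $\{0,1\}^\Gamma$); $\Gamma$ acts on it by conjugation. A uniformly recurrent subgroup (URS) of $\Gamma$ is a minimal (nonempty) closed $\Gamma$-invariant subset of $\mathrm{Sub}(\Gamma)$. A URS is amenable if every subgroup belonging to it is amenable. For URS's $\mathcal{U},\mathcal{V}$, write $\mathcal{U}\preccurlyeq\mathcal{V}$ if there exist $H\in\mathcal{U}$ and $K\in\mathcal{V}$ with $H\le K$; ''$\mathcal U$ is dominated by $\mathcal V$'' means $\mathcal U\preccurlyeq\mathcal V$. The stability system $\mathcal{S}_X$ of a compact $\Gamma$-space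 $X$ is the closure in $\mathrm{Sub}(\Gamma)$ of $\{\Gamma_x : x\in X,\ \Gamma_x=\Gamma_x^\circ\}$. A $\Gamma$-operator system is an operator system with a $\Gamma$-action by unital complete order isomorphisms; a $\Gamma$-morphism is a $\Gamma$-equivariant unital completely positive map. A $\Gamma$-operator system $V$ is $\Gamma$-injective if for all $\Gamma$-operator systems $W_0\subset W$ every $\Gamma$-morphism $W_0\to V$ extends to a $\Gamma$-morphism $W\to V$. For a compact $\Gamma$-space $X$, $\tilde X$ denotes the Gelfand spectrum of the $\Gamma$-injective envelope of $C(X)$ (Hamana): $C(\tilde X)$ is a commutative unital $C^*$-algebra with $\Gamma$-action that is a $\Gamma$-injective operator system, contains $C(X)$ as a unital $\Gamma$-invariant $C^*$-subalgebra equivariantly, and is rigid, i.e. the identity map is the only $\Gamma$-morphism $C(\tilde X)\to C(\tilde X)$ that is the identity on $C(X)$. Thus $\tilde X$ is a compact $\Gamma$-space. *)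

(* Defs.v *)
From HB Require Import structures.
From mathcomp Require Import all_boot all_order all_algebra.
From mathcomp Require Import all_classical all_reals all_analysis.
From mathcomp Require Import complex ring lra.

Set Implicit Arguments.
Unset Strict Implicit.
Unset Printing Implicit Defensive.

Import Order.TTheory GRing.Theory Num.Def Num.Theory.
Import numFieldNormedType.Exports.

Local Open Scope classical_set_scope.
Local Open Scope complex_scope.
Local Open Scope ring_scope.
Local Open Scope sesquilinear_scope.

Section Subgroups.
Variable G : groupType.

(* Subgroups as points of {0,1}^G. *)
Record subgroup := Subgroup {
  sg_mem : {ptws G -> bool};
  sg_closed : group_closed (sg_mem : {pred G}) }.

Lemma subgroup_inj : injective sg_mem.
Proof.
move=> [p pc] [q qc] /= epq; subst q; congr Subgroup.
exact: Prop_irrelevance.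
Qed.

HB.instance Definition _ := gen_eqMixin subgroup.
HB.instance Definition _ := gen_choiceMixin subgroup.
(* Chabauty topology: relative topology of the product topology. *)
HB.instance Definition _ :=
  Topological.copy subgroup (initial_topology sg_mem).

Definition sg_le (H K : subgroup) := forall x, sg_mem H x -> sg_mem K x.

Definition sg_type (H : subgroup) := {x : G | sg_mem H x}.

HB.instance Definition _ (H : subgroup) := SubChoice.on (sg_type H).
HB.instance Definition _ (H : subgroup) :=
  SubChoice_isSubGroup.Build G _ (sg_type H) (sg_closed H).

Lemma sg_conj_closed (g : G) (H : subgroup) :
  group_closed ((fun x => sg_mem H (x ^ g)%g) : {pred G}).
Proof.
case: (sg_closed H) => H1 HF; split=> [|x y]; first by rewrite unfold_in conj1g.
by rewrite !unfold_in conjMg conjVg; exact: HF.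
Qed.

(* x ^ g is g^-1 * x * g, so this is the subgroup g H g^-1. *)
Definition sg_conj (g : G) (H : subgroup) : subgroup :=
  Subgroup (sg_conj_closed g H).

Definition closed_invariant (A : set subgroup) :=
  [/\ closed A, A !=set0 & forall g H, A H -> A (sg_conj g H)].

Definition is_URS (A : set subgroup) :=
  closed_invariant A /\
  (forall B, closed_invariant B -> B `<=` A -> B = A).

Definition urs_le (U V : set subgroup) :=
  exists H K, [/\ U H, V K & sg_le H K].

End Subgroups.

Definition invariant_mean (R : realType) (H : groupType)
    (m : (H -> R^o) -> R) :=
  [/\ forall (a : R) (f g : H -> R^o), bounded_fun f -> bounded_fun g ->
        m (a *: f + g) = a * m f + m g,
      m (cst 1) = 1,
      forall f : H -> R^o, bounded_fun f -> (forall x, 0 <= f x) -> 0 <= m f &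
      forall h (f : H -> R^o), bounded_fun f -> m (fun x => f (h * x)%g) = m f].

Definition amenable (R : realType) (H : groupType) :=
  exists m : (H -> R^o) -> R, invariant_mean m.

Definition amenable_URS (R : realType) (G : groupType)
    (U : set (subgroup G)) :=
  is_URS U /\ forall H, U H -> amenable R (sg_type H).

Record compact_gspace (G : groupType) := CompactGSpace {
  gs_space :> topologicalType;
  gs_act : G -> gs_space -> gs_space;
  gs_nonempty : [set: gs_space] !=set0;
  gs_compact : compact [set: gs_space];
  gs_hausdorff : hausdorff_space gs_space;
  gs_act1 : forall x, gs_act 1%g x = x;
  gs_actM : forall g h x, gs_act (g * h)%g x = gs_act g (gs_act h x);
  gs_act_continuous : forall g, continuous (gs_act g) }.

Section Stability.
Variables (G : groupType) (X : compact_gspace G).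

Lemma gs_actK g : cancel (@gs_act G X g) (gs_act g^-1%g).
Proof. by move=> x; rewrite -gs_actM mulVg gs_act1. Qed.

Lemma gs_actVK g : cancel (@gs_act G X g^-1%g) (gs_act g).
Proof. by move=> x; rewrite -gs_actM mulgV gs_act1. Qed.

Lemma stab_closed (x : X) :
  group_closed ((fun g => `[< gs_act g x = x >]) : {pred G}).
Proof.
split=> [|g h]; first by rewrite unfold_in; apply/asboolP; exact: gs_act1.
rewrite !unfold_in => /asboolP gx /asboolP hx; apply/asboolP.
by rewrite gs_actM -{1}hx gs_actK.
Qed.

Definition stab (x : X) : subgroup G := Subgroup (stab_closed x).

Lemma stab0_closed (x : X) :
  group_closed ((fun g => `[< \forall y \near x, gs_act g y = y >]) : {pred G}).
Proof.
split=> [|g h].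
  by rewrite unfold_in; apply/asboolP; near=> y; exact: gs_act1.
rewrite !unfold_in => /asboolP gx /asboolP hx; apply/asboolP.
near=> y; rewrite gs_actM.
have hy : gs_act h y = y by near: y.
by rewrite -{1}hy gs_actK; near: y.
Unshelve. all: by end_near. Qed.

Definition stab0 (x : X) : subgroup G := Subgroup (stab0_closed x).

Definition stability_system : set (subgroup G) :=
  closure [set stab x | x in [set x | stab x = stab0 x]].

End Stability.

Section Compression.
Variables (R : realType) (V : lmodType R[i]).

(* A^* X A, for a scalar matrix A and a matrix X over V. *)
Definition compress m n (A : 'M[R[i]]_(m, n)) (X : 'M[V]_m) : 'M[V]_n :=
  \matrix_(i, j) \sum_k \sum_l ((conjC (A k i) * A l j) *: X k l).

Definition diag_const n (e : V) : 'M[V]_n :=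
  \matrix_(i, j) (if i == j then e else 0).

Definition selfadjoint_mx (star : V -> V) n (X : 'M[V]_n) :=
  forall i j, star (X i j) = X j i.

End Compression.

(* Abstract (Choi-Effros) operator systems: matrix-ordered *-vector spaces with
   an Archimedean matrix order unit.  In R[i], 0 < a entails that a is real.
   Closure of the cones under nonnegative scaling is compression by a scalar
   matrix. *)
Record opsys (R : realType) := OpSys {
  os_sort :> lmodType R[i];
  os_star : os_sort -> os_sort;
  os_one : os_sort;
  os_pos : forall n, set ('M[os_sort]_n);
  os_starK : involutive os_star;
  os_starD : forall x y, os_star (x + y) = os_star x + os_star y;
  os_starZ : forall a x, os_star (a *: x) = conjC a *: os_star x;
  os_pos_selfadjoint : forall n (X : 'M[os_sort]_n),
    os_pos X -> selfadjoint_mx os_star X;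
  os_pos0 : forall n, os_pos (0 : 'M[os_sort]_n);
  os_posD : forall n (X Y : 'M[os_sort]_n), os_pos X -> os_pos Y -> os_pos (X + Y);
  os_pos_proper : forall n (X : 'M[os_sort]_n), os_pos X -> os_pos (- X) -> X = 0;
  os_pos_compress : forall m n (A : 'M[R[i]]_(m, n)) (X : 'M[os_sort]_m),
    os_pos X -> os_pos (compress A X);
  os_order_unit : forall n (X : 'M[os_sort]_n), selfadjoint_mx os_star X ->
    exists2 a : R[i], 0 < a & os_pos (diag_const n (a *: os_one) + X);
  os_archimedean : forall n (X : 'M[os_sort]_n),
    (forall a : R[i], 0 < a -> os_pos (diag_const n (a *: os_one) + X)) ->
    os_pos X }.

Arguments os_star {R o}.
Arguments os_pos {R o n}.

Record gopsys (R : realType) (G : groupType) := GOpSys {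
  go_opsys :> opsys R;
  go_act : G -> go_opsys -> go_opsys;
  go_act1 : forall x, go_act 1%g x = x;
  go_actM : forall g h x, go_act (g * h)%g x = go_act g (go_act h x);
  go_act_linear : forall g, linear (go_act g);
  go_act_one : forall g, go_act g (os_one go_opsys) = os_one go_opsys;
  go_act_order : forall g n (X : 'M[go_opsys]_n),
    os_pos (map_mx (go_act g) X) <-> os_pos X }.

Section Morphisms.
Variables (R : realType) (G : groupType).

Definition completely_positive (V W : opsys R) (phi : V -> W) :=
  forall n (X : 'M[V]_n), os_pos X -> os_pos (map_mx phi X).

Definition equivariant (V W : gopsys R G) (phi : V -> W) :=
  forall g x, phi (go_act g x) = go_act g (phi x).

Definition gmorphism (V W : gopsys R G) (phi : V -> W) :=
  [/\ linear phi, phi (os_one V) = os_one W,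
      completely_positive phi & equivariant phi].

(* Realizes V as a G-operator subsystem of W: the matrix order of V is the one
   induced by W; injectivity follows from os_pos_proper. *)
Definition gsubsystem (V W : gopsys R G) (iota : V -> W) :=
  gmorphism iota /\
  forall n (X : 'M[V]_n), os_pos (map_mx iota X) -> os_pos X.

Definition ginjective (V : gopsys R G) :=
  forall (W0 W : gopsys R G) (iota : W0 -> W) (phi : W0 -> V),
    gsubsystem iota -> gmorphism phi ->
    exists2 psi : W -> V, gmorphism psi & forall x, psi (iota x) = phi x.

End Morphisms.

Section ContinuousFunctions.
Variables (R : realType) (X : topologicalType).

Definition continuous_pred : {pred X -> R[i]^o} := fun f => `[< continuous f >].

Record cfun := CFun {
  cfun_val :> X -> R[i]^o;
  cfun_valP : cfun_val \in continuous_pred }.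

HB.instance Definition _ := [isSub for cfun_val].
HB.instance Definition _ := [Choice of cfun by <:].

Lemma cfun_continuous (f : cfun) : continuous f.
Proof. by apply/asboolP; exact: cfun_valP. Qed.

Lemma continuous_subring : subring_closed continuous_pred.
Proof.
split=> [|f g|f g].
- by apply/asboolP => x; exact: cst_continuous.
- move=> /asboolP fc /asboolP gc; apply/asboolP => x.
  exact: (continuousB (fc x) (gc x)).
- move=> /asboolP fc /asboolP gc; apply/asboolP => x.
  exact: (continuousM (fc x) (gc x)).
Qed.

Lemma continuous_scaler : @GRing.scaler_closed R[i] (X -> R[i]^o) continuous_pred.
Proof.
move=> a f /asboolP fc; apply/asboolP => x.
exact: (@continuousZl_tmp R[i] R[i]^o X f a x (fc x)).
Qed.

HB.instance Definition _ := GRing.isSubringClosed.Build _ continuous_pred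
  continuous_subring.
HB.instance Definition _ := GRing.isScaleClosed.Build _ _ continuous_pred
  continuous_scaler.
HB.instance Definition _ :=
  GRing.SubChoice_isSubComPzRing.Build _ _ cfun (subringClosedP continuous_pred).
HB.instance Definition _ :=
  GRing.SubZmodule_isSubLmodule.Build _ _ _ cfun
    (GRing.subsemimodClosedP continuous_pred).

Lemma conjC_continuous : continuous (conjC : R[i]^o -> R[i]^o).
Proof.
move=> z A [e e0 sA]; exists e => // w zw; apply: sA.
by rewrite /= -rmorphB norm_conjC.
Qed.

Lemma cfun_star_subproof (f : cfun) :
  (fun x => conjC (f x) : R[i]^o) \in continuous_pred.
Proof.
apply/asboolP => x; apply: continuous_comp; first exact: cfun_continuous.
exact: conjC_continuous.
Qed.

Definition cfun_star (f : cfun) : cfun := CFun (cfun_star_subproof f).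

End ContinuousFunctions.

Section PositiveSemidefinite.
Variable C : numClosedFieldType.

Definition psdmx n (M : 'M[C]_n) :=
  M ^t* = M /\ forall v : 'cV[C]_n, 0 <= (v ^t* *m M *m v) 0 0.

Lemma trmxCE m n (A : 'M[C]_(m, n)) i j : (A ^t*) i j = conjC (A j i).
Proof. by rewrite !mxE. Qed.

Lemma trmxC_mul m n p (A : 'M[C]_(m, n)) (B : 'M[C]_(n, p)) :
  (A *m B) ^t* = B ^t* *m A ^t*.
Proof. by rewrite trmx_mul map_mxM. Qed.

Lemma psdmx0 n : psdmx (0 : 'M[C]_n).
Proof.
split=> [|v]; first by apply/matrixP => i j; rewrite !mxE conjC0.
by rewrite mulmx0 mul0mx mxE.
Qed.

Lemma psdmxD n (M N : 'M[C]_n) : psdmx M -> psdmx N -> psdmx (M + N).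
Proof.
move=> [hM pM] [hN pN]; split=> [|v].
  by rewrite linearD /= map_mxD hM hN.
by rewrite mulmxDr mulmxDl mxE addr_ge0.
Qed.

Lemma psdmx_compress m n (A : 'M[C]_(m, n)) (M : 'M[C]_m) :
  psdmx M -> psdmx (A ^t* *m M *m A).
Proof.
move=> [hM pM]; split=> [|v].
  by rewrite !trmxC_mul trmxCK hM mulmxA.
by have := pM (A *m v); rewrite trmxC_mul !mulmxA.
Qed.

Lemma quad_formE n (M : 'M[C]_n) (v : 'cV[C]_n) :
  (v ^t* *m M *m v) 0 0 = \sum_i \sum_j conjC (v i 0) * M i j * v j 0.
Proof.
rewrite mxE exchange_big; apply: eq_bigr => j _; rewrite mxE mulr_suml.
by apply: eq_bigr => i _; rewrite !mxE.
Qed.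

Lemma psdmx_proper n (M : 'M[C]_n) : psdmx M -> psdmx (- M) -> M = 0.
Proof.
move=> [_ pM] [_ nM].
have q0 (v : 'cV[C]_n) : (v ^t* *m M *m v) 0 0 = 0.
  apply/eqP; rewrite eq_le pM andbT -oppr_ge0.
  by have := nM v; rewrite mulmxN mulNmx mxE.
have e2 i j (a : C) :
    conjC a * M j i + a * M i j + M i i + conjC a * a * M j j = 0.
  have := q0 (delta_mx i 0 + a *: delta_mx j 0).
  have -> : (delta_mx i 0 + a *: delta_mx j 0 : 'cV[C]_n) ^t* =
      delta_mx 0 i + conjC a *: delta_mx 0 j.
    apply/matrixP => k l; rewrite !mxE rmorphD rmorphM /=.
    by rewrite (andbC (l == i)) (andbC (l == j)) !rmorph_nat.
  have eM k l : ((delta_mx 0 k : 'rV[C]_n) *m M *m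
      (delta_mx l 0 : 'cV[C]_n)) 0 0 = M k l.
    by rewrite -rowE -colE !mxE.
  rewrite mulmxDl mulmxDl !mulmxDr -!scalemxAl -!scalemxAr scalerA.
  have addE (A B : 'M[C]_1) : (A + B) 0 0 = A 0 0 + B 0 0 by rewrite mxE.
  have scaleE b (A : 'M[C]_1) : (b *: A) 0 0 = b * A 0 0 by rewrite mxE.
  rewrite !(addE, scaleE) !eM.
  by move=> <-; ring.
have d0 i : M i i = 0.
  by have := e2 i i 0; rewrite conjC0 !mul0r !add0r addr0.
apply/matrixP => i j; rewrite mxE.
have := e2 i j 1; have := e2 i j 'i.
rewrite !d0 conjC1 conjCi !mulr0 !addr0 !mul1r => h1 h2.
have : (2 * 'i) * M i j = 0 by rewrite -(mulr0 'i) -h2 -[RHS]addr0 -h1; ring.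
by move/eqP; rewrite !mulf_eq0 pnatr_eq0 (negPf (neq0Ci _)) => /eqP.
Qed.

Lemma quad_form_scalar n (a : C) (v : 'cV[C]_n) :
  (v ^t* *m a%:M *m v) 0 0 = a * \sum_i `|v i 0| ^+ 2.
Proof.
rewrite mul_mx_scalar -scalemxAl mxE; congr (_ * _); rewrite mxE.
by apply: eq_bigr => i _; rewrite !mxE normCKC.
Qed.

Lemma quad_form_real n (M : 'M[C]_n) (v : 'cV[C]_n) :
  M ^t* = M -> (v ^t* *m M *m v) 0 0 \is Num.real.
Proof.
move=> hM; apply/CrealP.
have {2}<- : (v ^t* *m M *m v) ^t* = v ^t* *m M *m v.
  by rewrite !trmxC_mul trmxCK hM mulmxA.
by rewrite trmxCE.
Qed.

Lemma psdmx1 n : psdmx (1%:M : 'M[C]_n).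
Proof.
split=> [|v]; first by rewrite tr_scalar_mx map_scalar_mx /= conjC1.
by rewrite quad_form_scalar mul1r sumr_ge0// => i _; rewrite exprn_ge0.
Qed.

Lemma psdmx_archimedean n (M : 'M[C]_n) :
  (forall a : C, 0 < a -> psdmx (a%:M + M)) -> psdmx M.
Proof.
move=> aM; have hM : M ^t* = M.
  have [h _] := aM 1 ltr01; move: h.
  rewrite linearD map_mxD /= tr_scalar_mx map_scalar_mx /= conjC1.
  exact: addrI.
split=> // v; have qR := quad_form_real v hM; set q := (_ *m _ *m v) 0 0 in qR *.
rewrite real_leNgt ?real0//; apply/negP => q0.
pose s := \sum_i `|v i 0| ^+ 2.
have s1 : 0 < s + 1 by rewrite ltr_wpDl ?sumr_ge0// => i _; rewrite exprn_ge0.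
have e0 : 0 < - q / (s + 1) by rewrite divr_gt0 ?oppr_gt0.
have [_ /(_ v)] := aM _ e0.
rewrite mulmxDr mulmxDl mxE quad_form_scalar -/s -/q.
have -> : - q / (s + 1) * s + q = q / (s + 1).
  by field; rewrite (gt_eqF s1).
by rewrite pmulr_lge0 ?invr_gt0// => /(lt_le_trans q0); rewrite ltxx.
Qed.

Lemma psdmx_bounded n (M : 'M[C]_n) (b : C) : M ^t* = M ->
  (forall i j, `|M i j| <= b) -> psdmx ((b *+ n *+ 2)%:M + M).
Proof.
move=> hM Mb; split=> [|v].
  rewrite linearD map_mxD /= tr_scalar_mx map_scalar_mx /= hM; congr (_%:M + _).
  case: n M hM Mb => [|n] M hM Mb; first by rewrite mulr0n mul0rn conjC0.
  apply/CrealP; rewrite rpredMn// rpredMn// ger0_real//.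
  exact: le_trans (normr_ge0 _) (Mb 0 0).
rewrite mulmxDr mulmxDl mxE quad_form_scalar.
have qR := quad_form_real v hM; set q := (_ *m M *m v) 0 0 in qR *.
suff : `|q| <= b *+ n *+ 2 * \sum_i `|v i 0| ^+ 2.
  by rewrite real_ler_norml// => /andP[+ _]; rewrite lerNl -subr_ge0 opprK.
rewrite /q quad_formE.
apply: (@le_trans _ _ (\sum_i \sum_j b * (`|v i 0| ^+ 2 + `|v j 0| ^+ 2))).
  apply: le_trans (ler_norm_sum _ _ _) _; apply: ler_sum => i _.
  apply: le_trans (ler_norm_sum _ _ _) _; apply: ler_sum => j _.
  rewrite !normrM norm_conjC mulrAC mulrC ler_pM ?mulr_ge0//.
  have xR := normr_real (v i 0); have yR := normr_real (v j 0).
  have : 0 <= (`|v i 0| - `|v j 0|) ^+ 2 + (`|v i 0| ^+ 2 + `|v j 0| ^+ 2).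
    by rewrite addr_ge0 ?real_exprn_even_ge0 ?realB// addr_ge0 ?exprn_ge0.
  have -> : (`|v i 0| - `|v j 0|) ^+ 2 + (`|v i 0| ^+ 2 + `|v j 0| ^+ 2) =
    (`|v i 0| ^+ 2 + `|v j 0| ^+ 2 - `|v i 0| * `|v j 0|) *+ 2.
    ring.
  by rewrite pmulrn_lge0// subr_ge0.
under eq_bigr do rewrite -mulr_sumr big_split /= sumr_const card_ord.
rewrite -mulr_sumr big_split /= sumr_const card_ord.
rewrite le_eqVlt; apply/orP; left; apply/eqP.
by rewrite sumrMnl -mulr2n !mulrnAr !mulrnAl.
Qed.

End PositiveSemidefinite.

Section ContinuousFunctionsOpsys.
Variables (R : realType) (X : topologicalType).
Hypothesis cX : compact [set: X].
Local Notation C := R[i].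
Local Notation CX := (cfun R X).

Definition cfun_eval n (F : 'M[CX]_n) (x : X) : 'M[C]_n :=
  \matrix_(i, j) (F i j x : C).

(* The matrix order of the C*-algebra C(X): M_n(C(X)) = C(X, M_n). *)
Definition cfun_pos n : set 'M[CX]_n :=
  [set F | forall x, psdmx (cfun_eval F x)].

Lemma cfun_ext (f g : CX) : (forall x, f x = g x) -> f = g.
Proof. by move=> fg; apply/val_inj/funext. Qed.

Lemma cfunD (f g : CX) x : (f + g) x = f x + g x.
Proof. by []. Qed.

Lemma cfunN (f : CX) x : (- f) x = - f x.
Proof. by []. Qed.

Lemma cfunZ (a : C) (f : CX) x : (a *: f) x = a * f x.
Proof. by []. Qed.

Lemma cfunM (f g : CX) x : (f * g) x = f x * g x.
Proof. by []. Qed.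

Lemma cfun0 x : (0 : CX) x = 0.
Proof. by []. Qed.

Lemma cfun1 x : (1 : CX) x = 1.
Proof. by []. Qed.

Lemma cfun_sum I (r : seq I) (P : pred I) (F : I -> CX) x :
  (\sum_(i <- r | P i) F i) x = \sum_(i <- r | P i) F i x.
Proof. by elim/big_rec2: _ => // i y1 y2 _ <-. Qed.

Lemma cfun_evalD n (F H : 'M[CX]_n) x :
  cfun_eval (F + H) x = cfun_eval F x + cfun_eval H x.
Proof. by apply/matrixP => i j; rewrite !mxE. Qed.

Lemma cfun_eval_diag n (a : C) x :
  cfun_eval (diag_const n (a *: (1 : CX))) x = a%:M.
Proof.
apply/matrixP => i j; rewrite !mxE; case: eqP => _ //.
exact: mulr1.
Qed.

Lemma cfun_eval_compress m n (A : 'M[C]_(m, n)) (F : 'M[CX]_m) x :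
  cfun_eval (compress A F) x = A ^t* *m cfun_eval F x *m A.
Proof.
apply/matrixP => i j; rewrite [LHS]mxE [in LHS]mxE cfun_sum.
rewrite (eq_bigr (fun k => \sum_l conjC (A k i) * A l j * F k l x)); last first.
  by move=> k _; rewrite cfun_sum.
rewrite exchange_big [RHS]mxE; apply: eq_bigr => l _; rewrite mxE mulr_suml.
by apply: eq_bigr => k _; rewrite trmxCE [cfun_eval _ _ _ _]mxE mulrAC.
Qed.

Lemma cfun_eval_hermitian n (F : 'M[CX]_n) :
  selfadjoint_mx (@cfun_star R X) F <->
  forall x, (cfun_eval F x) ^t* = cfun_eval F x.
Proof.
split=> [hF x|hF i j].
  by apply/matrixP => i j; rewrite trmxCE !mxE -(hF j i).
apply: cfun_ext => x; have /matrixP/(_ j i) := hF x.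
by rewrite trmxCE !mxE.
Qed.

Lemma cfun_starK : involutive (@cfun_star R X).
Proof. by move=> f; apply: cfun_ext => x; exact: conjCK. Qed.

Lemma cfun_starD (f g : CX) :
  cfun_star (f + g) = cfun_star f + cfun_star g.
Proof. by apply: cfun_ext => x; rewrite cfunD; exact: rmorphD. Qed.

Lemma cfun_starZ (a : C) (f : CX) :
  cfun_star (a *: f) = conjC a *: cfun_star f.
Proof. by apply: cfun_ext => x; rewrite cfunZ; exact: rmorphM. Qed.

Lemma cfun_pos_selfadjoint n (F : 'M[CX]_n) :
  cfun_pos F -> selfadjoint_mx (@cfun_star R X) F.
Proof. by move=> pF; apply/cfun_eval_hermitian => x; case: (pF x). Qed.

Lemma cfun_pos0 n : cfun_pos (0 : 'M[CX]_n).
Proof.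
move=> x; have -> : cfun_eval (0 : 'M[CX]_n) x = 0.
  by apply/matrixP => i j; rewrite !mxE.
exact: psdmx0.
Qed.

Lemma cfun_posD n (F H : 'M[CX]_n) :
  cfun_pos F -> cfun_pos H -> cfun_pos (F + H).
Proof. by move=> pF pH x; rewrite cfun_evalD; exact: psdmxD. Qed.

Lemma cfun_pos_proper n (F : 'M[CX]_n) :
  cfun_pos F -> cfun_pos (- F) -> F = 0.
Proof.
move=> pF nF; apply/matrixP => i j; rewrite mxE; apply: cfun_ext => x.
have /matrixP/(_ i j) : cfun_eval F x = 0; last by rewrite !mxE.
apply: psdmx_proper (pF x) _.
suff -> : - cfun_eval F x = cfun_eval (- F) x by exact: nF.
by apply/matrixP => k l; rewrite !mxE.
Qed.

Lemma cfun_pos_compress m n (A : 'M[C]_(m, n)) (F : 'M[CX]_m) :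
  cfun_pos F -> cfun_pos (compress A F).
Proof. by move=> pF x; rewrite cfun_eval_compress; exact: psdmx_compress. Qed.

Lemma cfun_bounded (f : CX) : exists k : nat, forall x, `|f x : C| <= k%:R.
Proof.
have : \forall k \near \oo, [set: X] `<=` [set x | `|f x : C| <= k%:R].
  apply: (iffLR (compact_near_coveringP _) cX) => x _.
  have [m fm] : exists m : nat, `|f x : C| <= m%:R.
    exists (Num.bound (ComplexField.Normc.normc (f x))).
    rewrite [`|_|]/(real_complex R _) -(rmorph_nat (real_complex R)) lecR.
    by apply/ltW/archi_boundP; case: (f x) => a b; exact: sqrtr_ge0.
  exists ([set y | `|(f x : C) - f y| < 1], [set k | (m.+1 <= k)%N]).
    split; last by exists m.+1.
    apply: (@cfun_continuous R X f x [set z | `|(f x : C) - z| < 1]).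
    by exists 1 => //=; exact: ltr01.
  move=> [y k] [/= fy mk].
  rewrite -[X in `|X|](subKr (f x : C)); apply: le_trans (ler_normB _ _) _.
  apply: (@le_trans _ _ m.+1%:R); last by rewrite ler_nat.
  by rewrite -natr1; apply: lerD fm (ltW fy).
by move=> [k _ /(_ k (leqnn k)) kf]; exists k => x; exact: kf.
Qed.

Lemma cfun_order_unit n (F : 'M[CX]_n) : selfadjoint_mx (@cfun_star R X) F ->
  exists2 a : C, 0 < a & cfun_pos (diag_const n (a *: (1 : CX)) + F).
Proof.
move=> /cfun_eval_hermitian hF.
have [k kF] : exists k : nat, forall i j x, `|F i j x : C| <= k%:R.
  have /choice[K KP] : forall ij : 'I_n * 'I_n, exists k : nat,
      forall x, `|F ij.1 ij.2 x : C| <= k%:R by move=> ij; exact: cfun_bounded.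
  exists (\max_ij K ij) => i j x; apply: le_trans (KP (i, j) x) _.
  by rewrite ler_nat; exact: (leq_bigmax (i, j)).
exists (k%:R *+ n *+ 2 + 1) => [|x].
  by rewrite ltr_wpDl// mulrn_wge0// mulrn_wge0.
rewrite cfun_evalD cfun_eval_diag raddfD /= addrAC addrC.
apply: psdmxD; first exact: psdmx1.
by apply: psdmx_bounded (hF x) _ => i j; rewrite mxE.
Qed.

Lemma cfun_archimedean n (F : 'M[CX]_n) :
  (forall a : C, 0 < a -> cfun_pos (diag_const n (a *: (1 : CX)) + F)) ->
  cfun_pos F.
Proof.
move=> aF x; apply: psdmx_archimedean => a a0.
by have := aF a a0 x; rewrite cfun_evalD cfun_eval_diag.
Qed.

Definition cfun_opsys : opsys R :=
  OpSys cfun_starK cfun_starD cfun_starZ cfun_pos_selfadjoint cfun_pos0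
    cfun_posD cfun_pos_proper cfun_pos_compress cfun_order_unit cfun_archimedean.

End ContinuousFunctionsOpsys.

Section GammaFunctions.
Variables (R : realType) (G : groupType) (X : compact_gspace G).
Local Notation CX := (cfun R X).

Lemma cfun_act_subproof (g : G) (f : CX) :
  (fun x => f (gs_act g^-1%g x)) \in @continuous_pred R X.
Proof.
apply/asboolP => x; apply: continuous_comp; first exact: gs_act_continuous.
exact: cfun_continuous.
Qed.

Definition cfun_act (g : G) (f : CX) : CX := CFun (cfun_act_subproof g f).

Lemma cfun_act1 f : cfun_act 1%g f = f.
Proof. by apply: cfun_ext => x /=; rewrite invg1 gs_act1. Qed.

Lemma cfun_actM g h f : cfun_act (g * h)%g f = cfun_act g (cfun_act h f).
Proof. by apply: cfun_ext => x /=; rewrite invgM gs_actM. Qed.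

Lemma cfun_act_linear g : linear (cfun_act g).
Proof. by move=> a f h; apply: cfun_ext. Qed.

Lemma cfun_act_one g : cfun_act g 1 = 1.
Proof. exact: cfun_ext. Qed.

Lemma cfun_act_order g n (F : 'M[CX]_n) :
  cfun_pos (map_mx (cfun_act g) F) <-> cfun_pos F.
Proof.
have E x : cfun_eval (map_mx (cfun_act g) F) x = cfun_eval F (gs_act g^-1%g x).
  by apply/matrixP => i j; rewrite !mxE.
split=> pF x; last by rewrite E.
by have := pF (gs_act g x); rewrite E gs_actK.
Qed.

Definition CX_gopsys : gopsys R G :=
  @GOpSys R G (cfun_opsys R (@gs_compact G X)) cfun_act cfun_act1 cfun_actM
    cfun_act_linear cfun_act_one cfun_act_order.

End GammaFunctions.

Section Envelope.
Variables (R : realType) (G : groupType) (X Y : compact_gspace G).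

(* An injective unital *-homomorphism (its image is automatically a closed
   *-subalgebra, since it is isometric). *)
Definition gstar_embedding (iota : CX_gopsys R X -> CX_gopsys R Y) :=
  [/\ linear iota, iota (1 : cfun R X) = (1 : cfun R Y),
      forall f h : cfun R X, iota (f * h) = (iota f : cfun R Y) * iota h,
      forall f : cfun R X, iota (cfun_star f) = cfun_star (iota f : cfun R Y) &
      injective iota /\ equivariant iota].

Definition grigid (iota : CX_gopsys R X -> CX_gopsys R Y) :=
  forall phi : CX_gopsys R Y -> CX_gopsys R Y,
    gmorphism phi -> (forall f, phi (iota f) = iota f) -> phi = id.

(* C(Y) with the inclusion iota : C(X) -> C(Y) is the G-injective envelope of
   C(X); envelopes being unique up to isomorphism over C(X), this determines
   the G-space Y up to G-homeomorphism. *)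
Definition is_ginjective_envelope (iota : CX_gopsys R X -> CX_gopsys R Y) :=
  [/\ ginjective (CX_gopsys R Y), gstar_embedding iota & grigid iota].

End Envelope.

(* Main.v *)
Require Import Defs.
From HB Require Import structures.
From mathcomp Require Import all_boot all_order all_algebra.
From mathcomp Require Import all_classical all_reals all_analysis.
From mathcomp Require Import complex ring.

(** Write Y for the space called Xt below.  A point is generic when its
    stabilizer acts trivially near it; generic points are dense (Baire), and a
    limit of stabilizers stays inside the stabilizer of the limit point.  So
    every stabilizer contains a member of the stability system, every member
    of the stability system lies in a stabilizer, and comparisons between
    stabilizers pass to comparisons between members of closed sets of
    subgroups by compactness of Sub(G).

    All the operator theory goes through one G-operator system, the bounded
    functions on G x X with G translating the first factor.  It contains C(X)
    by means of f |-> ((g, x) |-> f(g x)), so injectivity of C(Y) yields a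
    G-morphism psi from it to C(Y) extending the inclusion of C(X).  On the
    other hand any choice of states mu_x of C(Y), one over each point x of X,
    gives a G-morphism from C(Y) to it, f |-> ((g, x) |-> mu_x(g^-1 f)), and by
    rigidity psi is a left inverse of that map (orbit_retraction).  This fact
    is used with three kinds of input.

    First, psi alone: evaluating psi at a point y gives an invariant mean for
    stab y, so every subgroup of a point stabilizer of Y is amenable
    (amenable_sub_stab).

    Second, point masses mu_x: they show that Y cannot be shrunk to a proper
    closed invariant subset that still maps onto X, from which a generic y has
    its stabilizer below a member of the stability system of X
    (generic_stab_below).

    Third, invariant states: let U be an amenable URS below the stability
    system of X.  As that system is a URS, each stab x contains some H_x in U,
    and amenability gives an H_x-invariant mu_x over x.  A bump function at y
    separated from its translates by the elements t that move y has mass at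
    most 1/2 under a t-invariant state, while psi recovers its value 1 at y; so
    some conjugate of some H_x avoids finitely many given elements outside
    stab y, and compactness puts a member of U inside stab y
    (amenable_URS_below_stab).

    Consequently every URS in the stability system of Y is amenable, lies below
    the stability system of X, and lies above every amenable URS with that
    property.  Two such URSs dominate each other, hence are equal by
    antisymmetry (urs_le_anti); one exists by Zorn's lemma. *)

Set Implicit Arguments.
Unset Strict Implicit.
Unset Printing Implicit Defensive.

Import Order.TTheory GRing.Theory Num.Def Num.Theory.
Import numFieldNormedType.Exports.

Local Open Scope classical_set_scope.

(** * Compact Hausdorff spaces *)

Section CompactSpaces.
Variable T : topologicalType.

Lemma compact_fip (I : choiceType) (K : set T) (C : I -> set T) :
  compact K -> (forall i, closed (C i)) ->
  (forall s : seq I, exists x, K x /\ forall i, i \in s -> C i x) ->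
  exists x, K x /\ forall i, C i x.
Proof.
move=> cK cC fip.
pose B (s : seq I) := [set x | K x /\ forall i, i \in s -> C i x].
have FB s : filter_from setT B (B s) by exists s.
have FF : ProperFilter (filter_from setT B).
  apply: filter_from_proper; last by move=> s _; exact: fip.
  apply: filter_fromT_filter; first by exists [::].
  move=> s t; exists (s ++ t) => x [Kx h].
  by split; split=> // i si; apply: h; rewrite mem_cat si ?orbT.
have [|x [Kx clx]] := cK _ FF; first by exists [::] => // x [].
exists x; split=> // i; apply: cC => A Ax.
have [z [[_ Cz] Az]] := clx _ _ (FB [:: i]) Ax.
by exists z; split=> //; apply: Cz; rewrite inE.
Qed.

Hypotheses (cT : compact [set: T]) (hT : hausdorff_space T).

Lemma shrink_open (x : T) (W : set T) : open W -> W x ->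
  exists U : set T, [/\ open U, U x & closure U `<=` W].
Proof.
move=> oW Wx.
have rx := @compact_regular T x setT hT cT filterT.
have [B nB cB] := rx _ W (open_nbhs_nbhs (conj oW Wx)).
exists B°; split; [exact: open_interior|exact: nB|].
exact: subset_trans (closureS (@interior_subset _ B)) cB.
Qed.

(** The Baire category theorem in the form needed for compact Hausdorff
    spaces: nested closures of open sets replace the Cauchy sequence of the
    metric proof. *)
Lemma compact_baire (D : nat -> set T) :
  (forall n, open (D n)) -> (forall n, dense (D n)) ->
  dense [set x | forall n, D n x].
Proof.
move=> oD dD O O0 oO.
pose S := {U : set T | open U /\ U !=set0}.
have step (n : nat) (U : S) :
    {V : S | closure (sval V) `<=` sval U `&` D n}.
  apply: cid; case: U => U [oU U0] /=.
  have [x [Ux Dx]] := dD n U U0 oU.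
  have [V [oV Vx cV]] := shrink_open (openI oU (oD n)) (conj Ux Dx).
  have V0 : V !=set0 by exists x.
  by exists (exist _ V (conj oV V0)).
pose U_ := fix U_ n : S :=
  if n is m.+1 then sval (step m (U_ m)) else exist _ O (conj oO O0).
have UD n : closure (sval (U_ n.+1)) `<=` sval (U_ n) `&` D n.
  exact: (svalP (step n (U_ n))).
have Udec m n : (m <= n)%N -> sval (U_ n) `<=` sval (U_ m).
  elim: n => [|n IH]; first by rewrite leqn0 => /eqP ->.
  rewrite leq_eqVlt => /orP[/eqP -> //|]; rewrite ltnS => /IH mn.
  by apply: subset_trans mn => x /subset_closure /UD [].
have [|s|x [_ Ux]] := compact_fip (C := fun n => closure (sval (U_ n))) cT.
- by move=> n; exact: closed_closure.
- have [_ [x Ux]] := svalP (U_ (\max_(n <- s) n)).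
  exists x; split=> // n ns; apply: subset_closure; apply: Udec Ux.
  exact: leq_bigmax_seq.
- exists x; split; first by have [] := UD 0%N x (Ux 1%N).
  by move=> n; have [] := UD n x (Ux n.+1).
Qed.

End CompactSpaces.

(** * The space of subgroups and its uniformly recurrent subsets *)

Section Chabauty.
Variable G : groupType.
Implicit Types (H K L : subgroup G) (A B S U V : set (subgroup G)).

Lemma sg_le_anti H K : sg_le H K -> sg_le K H -> H = K.
Proof.
move=> HK KH; apply: subgroup_inj; apply: funext => x.
by apply/idP/idP; [exact: HK|exact: KH].
Qed.

Lemma sg_le_trans H K L : sg_le H K -> sg_le K L -> sg_le H L.
Proof. by move=> HK KL x /HK/KL. Qed.

Lemma sg_le_conj g H K : sg_le H K -> sg_le (sg_conj g H) (sg_conj g K).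
Proof. by move=> HK x; exact: HK. Qed.

Lemma sg_mem_continuous g : continuous (fun H => sg_mem H g).
Proof.
move=> H; apply: (@continuous_comp _ _ _ (@sg_mem G) (fun f => f g)).
  exact: initial_continuous.
exact: (@proj_continuous G (fun=> bool) g).
Qed.

Lemma clopen_bool (T : topologicalType) (f : T -> bool) :
  continuous f -> clopen [set x | f x].
Proof.
move=> cf; split.
  by apply: (open_comp (f := f) (D := [set b : bool | b])) => [x _|];
    [exact: cf|exact: discrete_open].
by apply: (closed_comp (f := f) (D := [set b : bool | b])) => [x _|];
  [exact: cf|exact: discrete_closed].
Qed.

Lemma clopen_mem g : clopen [set H : subgroup G | sg_mem H g].
Proof. exact/clopen_bool/sg_mem_continuous. Qed.

Lemma clopen_notin g : clopen [set H : subgroup G | ~~ sg_mem H g].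
Proof.
suff -> : [set H : subgroup G | ~~ sg_mem H g] = ~` [set H | sg_mem H g].
  have [om cm] := clopen_mem g.
  by split; [exact: closed_openC|exact: open_closedC].
by apply/seteqP; split=> H /negP.
Qed.

(** Sub(G) is closed in the compact space {0,1}^G, because being a subgroup is
    a conjunction of conditions on finitely many coordinates. *)
Lemma subgroup_compact : compact [set: subgroup G].
Proof.
have cpt : compact [set: {ptws G -> bool}].
  have := @tychonoff G (fun=> bool) (fun=> setT) (fun=> bool_compact).
  by congr compact; apply/seteqP.
move=> F FF _.
have [f [_ clf]] := cpt (@sg_mem G @ F) _ (filterT).
have ev g : clopen [set p : {ptws G -> bool} | p g].
  exact/clopen_bool/(@proj_continuous G (fun=> bool) g).
have inC (C : set {ptws G -> bool}) :
    closed C -> (forall H, C (sg_mem H)) -> C f.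
  move=> cC CH; apply: cC => B Bf.
  have [|p []] := clf C B _ Bf; last by exists p.
  by apply: (@filterS _ F _ setT) => [H _|]; [exact: CH|exact: filterT].
have gf : group_closed (f : {pred G}).
  split=> [|x y xf yf].
    by apply: inC (ev 1%g).2 _ => H; case: (sg_closed H).
  have cC : closed (~` ([set p : {ptws G -> bool} | p x]
      `&` [set p : {ptws G -> bool} | p y]
      `&` ~` [set p : {ptws G -> bool} | p (x / y)%g])).
    apply: open_closedC; apply: openI; last exact: closed_openC (ev _).2.
    by apply: openI; exact: (ev _).1.
  apply: contrapT => nxy.
  have /= [|//] := inC _ cC.
    by move=> H [[xH yH]]; apply; case: (sg_closed H) => _; exact.
exists (Subgroup gf); split=> // A B FA [B' [[W oW <-] Wf WB]].
have [|p [[H AH <-] Wp]] :=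
  clf (@sg_mem G @` A) W _ (open_nbhs_nbhs (conj oW Wf)).
  by apply: (@filterS _ F _ A) => // H AH; exists H.
by exists H; split=> //; apply: WB.
Qed.

(** The compactness principle behind every limit of subgroups below: to find a
    member of a closed set that contains P and avoids N, it is enough to do so
    for the traces of P and N on each finite set. *)
Lemma subgroup_compactness A (P N : set G) : closed A ->
  (forall s : seq G, exists H, [/\ A H,
     forall t, t \in s -> P t -> sg_mem H t &
     forall t, t \in s -> N t -> ~~ sg_mem H t]) ->
  exists H, [/\ A H, forall t, P t -> sg_mem H t &
                forall t, N t -> ~~ sg_mem H t].
Proof.
move=> cA fin.
pose C t := [set H | (P t -> sg_mem H t) /\ (N t -> ~~ sg_mem H t)].
have closedI (p : Prop) B : closed B -> closed [set H | p -> B H].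
  move=> cB; have [pT|pF] := pselect p.
    suff -> : [set H : subgroup G | p -> B H] = B by [].
    by apply/seteqP; split=> [H /(_ pT)|H BH _].
  suff -> : [set H | p -> B H] = setT by exact: closedT.
  by apply/seteqP; split=> // H _ /pF.
have cptA : compact A by apply: subclosed_compact cA subgroup_compact _.
have [t|s|H [AH CH]] := compact_fip (C := C) cptA.
- apply: (@topology_structure.closedI (subgroup G)).
  + by apply: closedI; exact: (clopen_mem t).2.
  + by apply: closedI; exact: (clopen_notin t).2.
- have [H [AH PH NH]] := fin s.
  by exists H; split=> // t ts; split; [exact: PH|exact: NH].
- by exists H; split=> // t; case: (CH t).
Qed.

Lemma closure_agree S K (s : seq G) : closure S K ->
  exists H, S H /\ forall t, t \in s -> sg_mem H t = sg_mem K t.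
Proof.
move=> clK.
suff nK : nbhs K [set H | forall t, t \in s -> sg_mem H t = sg_mem K t].
  by have [H [SH HK]] := clK _ nK; exists H.
elim: s => [|t s IH]; first exact: filterS filterT.
have nt : nbhs K [set H : subgroup G | sg_mem H t = sg_mem K t].
  apply: open_nbhs_nbhs; split=> //.
  case: (sg_mem K t).
    exact: (clopen_mem t).1.
  suff -> : [set H : subgroup G | sg_mem H t = false] = [set H | ~~ sg_mem H t]
    by exact: (clopen_notin t).1.
  by apply/seteqP; split=> H /= => [->|/negPf].
apply: filterS2 nt IH => H Ht Hs u; rewrite inE => /orP[/eqP -> //|]; exact: Hs.
Qed.

(** A conjugate of K is determined on a finite set s by K on the conjugate of
    s, so it is approximated there by conjugates of members of S; compactness
    produces a limit that can only be the conjugate itself. *)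
Lemma closure_conj S g : (forall H, S H -> S (sg_conj g H)) ->
  forall K, closure S K -> closure S (sg_conj g K).
Proof.
move=> iS K clK.
have [s|H [clH KH HK]] := subgroup_compactness
    (P := [set t | sg_mem (sg_conj g K) t])
    (N := [set t | ~~ sg_mem (sg_conj g K) t]) (@closed_closure _ S).
  have [H [SH HK]] := closure_agree [seq (t ^ g)%g | t <- s] clK.
  have e t : t \in s -> sg_mem (sg_conj g H) t = sg_mem (sg_conj g K) t.
    by move=> ts; apply: HK; exact: map_f.
  exists (sg_conj g H); split; first exact/subset_closure/iS.
  - by move=> t ts; rewrite e.
  - by move=> t ts; rewrite e.
suff -> : sg_conj g K = H by [].
by apply: sg_le_anti => t; [exact: KH|apply: contraTT => /HK].
Qed.

(** If K' in S agrees with K on a finite set, a member of U below K' avoids the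
    elements of that set outside K; compactness of U does the rest. *)
Lemma closure_has_sub S U : closed U ->
  (forall K, S K -> exists H, U H /\ sg_le H K) ->
  forall K, closure S K -> exists H, U H /\ sg_le H K.
Proof.
move=> cU SU K clK.
have [s|H [UH _ HK]] :=
    subgroup_compactness (P := set0) (N := [set t | ~~ sg_mem K t]) cU.
  have [K' [/SU[H [UH HK']] KK']] := closure_agree s clK.
  exists H; split=> // t ts /= nK; apply: contra nK => /HK'.
  by rewrite KK'.
by exists H; split=> // t; apply: contraTT => /HK.
Qed.

Lemma closure_has_sup S V : closed V ->
  (forall K, S K -> exists L, V L /\ sg_le K L) ->
  forall K, closure S K -> exists L, V L /\ sg_le K L.
Proof.
move=> cV SV K clK.
have [s|L [VL KL _]] :=
    subgroup_compactness (P := [set t | sg_mem K t]) (N := set0) cV.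
  have [K' [/SV[L [VL KL]] KK']] := closure_agree s clK.
  by exists L; split=> // t ts /= Kt; apply: KL; rewrite KK'.
by exists L.
Qed.

(** The members of V lying above some member of U form a closed invariant set,
    which minimality forces to be all of V; dually for [urs_le_sup]. *)
Lemma urs_le_sub U V : closed_invariant U -> is_URS V -> urs_le U V ->
  forall K, V K -> exists H, U H /\ sg_le H K.
Proof.
move=> [cU _ iU] [[cV _ iV] mV] [H0 [K0 [UH0 VK0 HK0]]].
pose B := [set K | V K /\ exists H, U H /\ sg_le H K].
have BV : B `<=` V by move=> K [].
have <- : B = V; last by move=> K [].
apply: mV => //; split.
- move=> K clK; split; first exact/cV/(closureS BV).
  by apply: (closure_has_sub (S := B)) clK => // L [].
- by exists K0; split=> //; exists H0.
- move=> g K [VK [H [UH HK]]]; split; first exact: iV.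
  by exists (sg_conj g H); split; [exact: iU|exact: sg_le_conj].
Qed.

Lemma urs_le_sup U V : is_URS U -> closed_invariant V -> urs_le U V ->
  forall H, U H -> exists K, V K /\ sg_le H K.
Proof.
move=> [[cU _ iU] mU] [cV _ iV] [H0 [K0 [UH0 VK0 HK0]]].
pose B := [set H | U H /\ exists K, V K /\ sg_le H K].
have BU : B `<=` U by move=> K [].
have <- : B = U; last by move=> K [].
apply: mU => //; split.
- move=> K clK; split; first exact/cU/(closureS BU).
  by apply: (closure_has_sup (S := B)) clK => // L [].
- by exists H0; split=> //; exists K0.
- move=> g K [UK [H [VH KH]]]; split; first exact: iU.
  by exists (sg_conj g H); split; [exact: iV|exact: sg_le_conj].
Qed.

(** The union of a chain in A is a limit of its members, so it is in A and
    Zorn's lemma applies. *)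
Lemma closed_has_maximal A : closed A -> A !=set0 ->
  exists2 H, A H & forall K, A K -> sg_le H K -> K = H.
Proof.
move=> cA [H0 AH0].
pose T := {H | A H}; pose le (H K : T) := `[< sg_le (sval H) (sval K) >].
have [t|r s t|s t|C totC|[H AH] maxH] := @Zorn T le.
- by apply/asboolP.
- by move=> /asboolP rs /asboolP st; apply/asboolP; exact: sg_le_trans st.
- by move=> /asboolP st /asboolP ts; apply: eq_sig_hprop;
    [move=> ?; exact: Prop_irrelevance|exact: sg_le_anti].
- have [[t0 Ct0]|C0] := pselect (C !=set0); last first.
    by exists (exist _ H0 AH0) => s Cs; case: C0; exists s.
  pose P := [set g | exists2 t, C t & sg_mem (sval t) g].
  have [s|H [AH PH _]] := subgroup_compactness (P := P) (N := set0) cA.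
    suff [t Ct ts] : exists2 t, C t &
        forall g, g \in s -> P g -> sg_mem (sval t) g.
      by exists (sval t); split=> //; exact: (svalP t).
    elim: s => [|g s [t Ct ts]]; first by exists t0.
    have [[u Cu ug]|nPg] := pselect (P g); last first.
      by exists t => // h; rewrite inE => /orP[/eqP -> //|]; exact: ts.
    have [/asboolP tu|/asboolP ut] := totC t u Ct Cu.
    - exists u => // h; rewrite inE => /orP[/eqP -> //|hs Ph].
      by apply: tu; exact: ts.
    - exists t => // h; rewrite inE => /orP[/eqP -> _|]; first exact: ut.
      exact: ts.
  by exists (exist _ H AH) => s Cs; apply/asboolP => g gs; apply: PH; exists s.
- exists H => // K AK HK.
  by have /(_ (asboolT HK))/(congr1 sval) := maxH (exist _ K AK).
Qed.

(** Domination is antisymmetric on URSs: a maximal element H of U lies below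
    some K in V, which lies below some H' in U, and maximality forces
    H = K = H'.  So U and V meet, and minimality makes them equal. *)
Lemma urs_le_anti U V : is_URS U -> is_URS V -> urs_le U V -> urs_le V U ->
  U = V.
Proof.
move=> uU uV UV VU.
have [[cU U0 iU] mU] := uU; have [[cV _ iV] mV] := uV.
have [H UH maxH] := closed_has_maximal cU U0.
have [K [VK HK]] := urs_le_sup uU uV.1 UV UH.
have [H' [UH' KH']] := urs_le_sup uV uU.1 VU VK.
have VH : V H.
  have eH : H' = H by apply: maxH UH' (sg_le_trans HK KH').
  by rewrite (sg_le_anti HK) // -eH.
have ciI : closed_invariant (U `&` V).
  split; [exact: closedI|by exists H|].
  by move=> g L [UL VL]; split; [exact: iU|exact: iV].
by rewrite -(mU _ ciI (@subIsetl _ _ _)) (mV _ ciI (@subIsetr _ _ _)).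
Qed.

(** By compactness a chain of nonempty closed sets has nonempty intersection,
    so Zorn's lemma gives a minimal closed invariant set. *)
Lemma closed_invariant_has_URS A : closed_invariant A ->
  exists2 B, is_URS B & B `<=` A.
Proof.
move=> ciA; pose P B := closed_invariant B /\ B `<=` A.
pose T := {B | P B}; pose le (B C : T) := `[< sval C `<=` sval B >].
have [t|r s t|s t|F totF|[B [ciB BA]] minB] := @Zorn T le.
- by apply/asboolP.
- by move=> /asboolP sr /asboolP ts; apply/asboolP; exact: subset_trans sr.
- by move=> /asboolP st /asboolP ts; apply: eq_sig_hprop;
    [move=> ?; exact: Prop_irrelevance|exact/seteqP].
- have [[t0 Ft0]|F0] := pselect (F !=set0); last first.
    have PA : P A by split.
    by exists (exist _ A PA) => s Fs; case: F0; exists s.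
  pose C (B : set (subgroup G)) :=
    [set H | (exists2 t, F t & sval t = B) -> B H].
  have [B|s|H [_ CH]] := compact_fip (C := C) subgroup_compact.
  + have [[t Ft tB]|nB] := pselect (exists2 t, F t & sval t = B).
      suff -> : C B = B by rewrite -tB; case: (svalP t) => -[].
      by apply/seteqP; split=> H; [apply; exists t|move=> BH _].
    suff -> : C B = setT by exact: closedT.
    by apply/seteqP; split=> // H _ /nB.
  + suff [t Ft ts] : exists2 t, F t & forall B, B \in s -> sval t `<=` C B.
      have [[_ [H tH] _] _] := svalP t.
      by exists H; split=> // B Bs; exact: ts tH.
    elim: s => [|B s [t Ft ts]]; first by exists t0.
    have [[u Fu uB]|nB] := pselect (exists2 t, F t & sval t = B); last first.
      exists t => // D; rewrite inE => /orP[/eqP ->|]; last exact: ts.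
      by move=> H _ /nB.
    have [/asboolP ut|/asboolP tu] := totF t u Ft Fu.
    * exists u => // D; rewrite inE => /orP[/eqP -> H uH _|Ds].
        by rewrite -uB.
      exact: subset_trans ut (ts _ Ds).
    * exists t => // D; rewrite inE => /orP[/eqP -> H tH _|]; last exact: ts.
      by rewrite -uB; exact: tu.
  pose I := \bigcap_(t in F) sval t.
  have It t : F t -> I `<=` sval t by move=> Ft K; exact.
  have PI : P I.
    split; last by apply: subset_trans (It _ Ft0) _; case: (svalP t0).
    split.
    + by apply: closed_bigI => t Ft; case: (svalP t) => -[].
    + by exists H => t Ft; apply: CH; exists t.
    + move=> g K IK t Ft; have [[_ _ it] _] := svalP t.
      by apply: it; exact: IK.
  by exists (exist _ I PI) => s Fs; apply/asboolP; exact: It.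
- exists B => //; split=> // D ciD DB.
  have PD : P D by split=> //; exact: (subset_trans DB BA).
  by have /(_ (asboolT DB))/(congr1 sval) := minB (exist _ D PD).
Qed.

End Chabauty.

(** * Stabilizers in compact spaces *)

Section StabilitySystems.
Variables (G : groupType) (X : compact_gspace G).
Implicit Types (x y : X) (g t : G).

Definition generic : set X := [set x | stab x = stab0 x].

Lemma stabP g x : sg_mem (stab x) g <-> gs_act g x = x.
Proof. by split=> [/asboolP|h]; [|apply/asboolP]. Qed.

Lemma moved_nbhs g x : gs_act g x <> x ->
  exists V : set X, [/\ open V, V x & forall z, V z -> ~ V (gs_act g z)].
Proof.
move=> /eqP gx.
have := @gs_hausdorff G X; rewrite open_hausdorff => /(_ _ _ gx).
move=> [[A B]] /= [/set_mem Agx /set_mem Bx] [oA oB /eqP].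
move=> /disjoints_subset AB.
exists (B `&` gs_act g @^-1` A); split.
- by apply: openI => //; apply: open_comp oA => z _; exact: gs_act_continuous.
- by [].
- by move=> z [_ Agz] [/(AB _ Agz)].
Qed.

Lemma closed_fix g : closed [set x : X | gs_act g x = x].
Proof.
rewrite -openC openE => x /= /moved_nbhs[V [oV Vx nV]].
apply: filterS (open_nbhs_nbhs (conj oV Vx)) => z Vz /= gz.
by apply: (nV z Vz); rewrite gz.
Qed.

(** A point moved by g stays moved nearby, so near any point there are enough
    neighbours whose stabilizer is no larger on a given finite set. *)
Lemma stab_usc x (s : seq G) :
  \forall y \near x, forall t, t \in s -> gs_act t x <> x -> gs_act t y <> y.
Proof.
elim: s => [|t s IH]; first exact: nearW.
have nt : \forall y \near x, gs_act t x <> x -> gs_act t y <> y.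
  have [tx|tx] := pselect (gs_act t x = x); first exact: nearW.
  have oF : open (~` [set x : X | gs_act t x = x]).
    by apply: closed_openC; exact: closed_fix.
  by apply: filterS (open_nbhs_nbhs (conj oF tx)) => y + _.
apply: filterS2 nt IH => y yt ys u; rewrite inE => /orP[/eqP -> //|].
exact: ys.
Qed.

Lemma fixed_near_act g t x : (\forall y \near x, gs_act t y = y) ->
  \forall y \near gs_act g x, gs_act (g * t * g^-1)%g y = y.
Proof.
move=> tx.
have nt : nbhs (gs_act g x) (gs_act g^-1%g @^-1` [set y | gs_act t y = y]).
  by apply: gs_act_continuous; rewrite gs_actK.
apply: filterS nt => y /= ty.
by rewrite !gs_actM ty gs_actVK.
Qed.

Lemma genericP x : generic x <->
  forall t, gs_act t x = x -> \forall y \near x, gs_act t y = y.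
Proof.
split=> [gx t /stabP|gx].
  by rewrite (gx : stab x = stab0 x) => /asboolP.
apply: sg_le_anti => t; first by move=> /stabP/gx tx; apply/asboolP.
by move=> /asboolP/nbhs_singleton tx; exact/stabP.
Qed.

Lemma stab_act g x : stab (gs_act g x) = sg_conj g (stab x).
Proof.
apply: subgroup_inj; apply: funext => t /=.
apply: asbool_equiv_eq; rewrite conjgE !gs_actM.
by split=> [->|tx]; rewrite ?gs_actK // -{2}tx gs_actVK.
Qed.

Lemma generic_act g x : generic x -> generic (gs_act g x).
Proof.
move=> /genericP gx; apply/genericP => t /stabP.
rewrite stab_act => /stabP/gx/(fixed_near_act g).
by rewrite conjgE !mulgA mulgV mul1g mulgK.
Qed.

(** For each t the points that are moved by t, or near which t acts trivially,
    form a dense open set; the generic points are those in all these countably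
    many sets. *)
Lemma generic_dense : countable [set: G] -> dense generic.
Proof.
move=> /countable_injP[f injf].
pose D g := [set x : X | gs_act g x = x -> \forall y \near x, gs_act g y = y].
have oD g : open (D g).
  suff -> : D g = ~` [set x : X | gs_act g x = x] `|`
      [set x : X | gs_act g x = x]°.
    by apply: openU; [exact: closed_openC (@closed_fix g)|exact: open_interior].
  apply/seteqP; split=> x /= => [Dx|[h /h //|nx _]]; last exact: nx.
  by have [/Dx|] := pselect (gs_act g x = x); [right|left].
have dD g : dense (D g).
  move=> O [x Ox] oO.
  have [[z [Oz gz]]|nO] := pselect (exists z, O z /\ gs_act g z <> z).
    by exists z; split=> // /gz.
  exists x; split=> // _.
  apply: filterS (open_nbhs_nbhs (conj oO Ox)) => z Oz.
  by apply: contrapT => gz; apply: nO; exists z.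
(* Indexing by f : G -> nat injective; E n is everything when n is missed. *)
pose E n := [set x : X | forall g, f g = n -> D g x].
have ED n : E n = setT \/ exists g, E n = D g.
  have [[g fg]|ng] := pselect (exists g, f g = n).
    right; exists g; apply/seteqP; split=> x; first exact.
    by move=> Dx h fh; suff -> : h = g by []; apply: injf; rewrite ?inE// fh.
  by left; apply/seteqP; split=> // x _ g fg; case: ng; exists g.
have oE n : open (E n).
  by case: (ED n) => [->|[g ->]]; [exact: openT|exact: oD].
have dE n : dense (E n).
  case: (ED n) => [->|[g ->]]; last exact: dD.
  by move=> O [x Ox] _; exists x.
have dI := compact_baire (@gs_compact G X) (@gs_hausdorff G X) oE dE.
move=> O O0 oO; have [x [Ox Ex]] := dI O O0 oO.
by exists x; split=> //; apply/genericP => t; exact: (Ex (f t) t).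
Qed.

Lemma generic_near (x : X) (P : set X) : countable [set: G] -> nbhs x P ->
  exists y, P y /\ generic y.
Proof.
move=> cG xP.
have [|y [Py gy]] := generic_dense cG (O := P°) _ (@open_interior _ P).
  by exists x.
by exists y; split=> //; exact: interior_subset.
Qed.

Lemma closed_stability_system : closed (stability_system X).
Proof. exact: closed_closure. Qed.

Lemma stability_system_closed_invariant :
  countable [set: G] -> closed_invariant (stability_system X).
Proof.
move=> cG; split; first exact: closed_stability_system.
  have [x0 _] := @gs_nonempty G X.
  have [|x [_ gx]] := generic_dense cG (O := setT) _ openT; first by exists x0.
  by exists (stab x); apply: subset_closure; exists x.
move=> g K; apply: closure_conj => _ [x gx <-].
exists (gs_act g x); [exact: generic_act|exact: stab_act].
Qed.

Lemma stab_in_stability_system x : generic x -> stability_system X (stab x).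
Proof. by move=> gx; apply: subset_closure; exists x. Qed.

(** Generic points close to x have, on any finite set, no stabilizing elements
    beyond those of x; a limit of their stabilizers lies in stab x. *)
Lemma stability_system_sub_stab x : countable [set: G] ->
  exists K, stability_system X K /\ sg_le K (stab x).
Proof.
move=> cG.
have [s|K [SK _ Kx]] := subgroup_compactness (P := set0)
    (N := [set t | ~~ sg_mem (stab x) t]) closed_stability_system.
  have [y [ny gy]] := generic_near cG (stab_usc x s).
  exists (stab y); split=> //; first exact: stab_in_stability_system.
  move=> t ts /= tx; apply/negP => /stabP; apply: ny => // /stabP.
  exact/negP.
exists K; split=> // t Kt; apply/negPn/negP => /Kx.
by rewrite Kt.
Qed.

(** Each finite part of K fixes a point; by compactness of X so does K. *)
Lemma stability_system_below_stab K : stability_system X K ->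
  exists x, sg_le K (stab x).
Proof.
move=> SK.
pose C t := [set x : X | sg_mem K t -> gs_act t x = x].
have [t|s|x [_ Cx]] := compact_fip (C := C) (@gs_compact G X).
- have [Kt|nKt] := boolP (sg_mem K t).
    suff -> : C t = [set x : X | gs_act t x = x] by exact: closed_fix.
    by apply/seteqP; rewrite /C Kt; split=> [x|x xt _ //]; exact.
  suff -> : C t = setT by exact: closedT.
  by apply/seteqP; split=> // x _ /=; rewrite /C /= (negPf nKt).
- have [_ [[x _ <-] xK]] := closure_agree s SK.
  by exists x; split=> // t ts; rewrite /C /= -(xK t ts) => /stabP.
- by exists x => t /Cx tx; exact/stabP.
Qed.

End StabilitySystems.

Local Open Scope ring_scope.
Local Open Scope complex_scope.
Local Open Scope sesquilinear_scope.

(** * Continuous functions and Gelfand duality *)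

Section ComplexFunctions.
Variables (R : realType) (X : topologicalType).
Local Notation C := R[i].
Local Notation CX := (cfun R X).

Lemma real_complex_continuous (f : X -> R) : continuous f ->
  continuous (fun x => (f x)%:C : C^o).
Proof.
move=> cf x A [e /= e0 sA].
have [er ei] : 0 < complex.Re e /\ complex.Im e = 0.
  by case: e e0 {sA} => a b /=; rewrite ltcE /= => /andP[/eqP -> ->].
have nf : nbhs x (f @^-1` ball (f x) (complex.Re e)).
  by apply: cf; exact: nbhsx_ballx.
apply: (@filterS _ (nbhs x) _ _ _ _ nf) => y; rewrite /ball /= => fxy.
apply: sA => /=.
rewrite -rmorphB normc_def /= expr0n addr0 sqrtr_sqr.
by case: e {e0 nf er} ei fxy => a b /= -> ab; rewrite ltcE /= eqxx.
Qed.

Lemma cfun_urysohn (x : X) (V : set X) :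
  compact [set: X] -> hausdorff_space X -> open V -> V x ->
  exists f : CX, [/\ f x = 1, forall z, 0 <= f z <= 1 &
                     forall z, ~ V z -> f z = 0].
Proof.
move=> cX hX oV Vx.
have nX := compact_normal hX cX.
have cx : closed [set x].
  by apply: accessible_closed_set1; exact: hausdorff_accessible.
have d0 : ~` V `&` [set x] = set0.
  by apply/seteqP; split=> // z [nVz /= zx]; apply: nVz; rewrite zx.
have [f [cf f0 f1 fr]] :=
  urysohn_ext_itv (R := R) nX (open_closedC oV) cx d0 ltr01.
have vf : (fun z => (f z)%:C : C^o) \in @continuous_pred R X.
  by apply/asboolP; exact: real_complex_continuous.
exists (CFun vf); split=> [|z|z nVz] /=.
- by have -> : f x = 1 by apply: f1; exists x.
- have : range f (f z) by exists z.
  by move=> /fr /=; rewrite in_itv /= => /andP[a b]; rewrite !lecR a b.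
- by have -> : f z = 0 by apply: f0; exists z.
Qed.

Lemma cfun_inv_subproof (f : CX) : (forall x, f x != 0) ->
  (fun x => (f x : C)^-1 : C^o) \in @continuous_pred R X.
Proof.
move=> f0; apply/asboolP => x.
apply: (@cvgV C _ (nbhs x) _ (fun x => f x : C) (f x)); first exact: f0.
exact: cfun_continuous.
Qed.

Lemma closed_cfun_level (f : CX) (a : C) : closed [set x | f x = a].
Proof.
have c1 : closed [set a : C^o].
  apply: accessible_closed_set1; apply: hausdorff_accessible.
  exact: norm_hausdorff.
by apply: closed_comp c1 => x _; exact: cfun_continuous.
Qed.

(** Gelfand duality for C(X): if finitely many f - chi(f) had no common zero,
    the sum of their squared moduli would be invertible, yet chi kills it.  So
    the level sets f = chi(f) have the finite intersection property. *)
Lemma character_is_evaluation (chi : CX -> C) : compact [set: X] ->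
  (forall a f h, chi (a *: f + h) = a * chi f + chi h) -> chi 1 = 1 ->
  (forall f h, chi (f * h) = chi f * chi h) ->
  exists x, forall f, chi f = f x.
Proof.
move=> cX lin one mul.
have chi0 : chi 0 = 0.
  by have := lin (-1) 0 0; rewrite scaler0 addr0 mulN1r addNr.
have chiD f h : chi (f + h) = chi f + chi h.
  by have := lin 1 f h; rewrite scale1r mul1r.
have chi_sum (s : seq CX) (F : CX -> CX) :
    chi (\sum_(f <- s) F f) = \sum_(f <- s) chi (F f).
  by elim/big_rec2: _ => // f y1 y2 _ <-.
have [f|s|x [_ hx]] :=
  compact_fip (C := fun f : CX => [set x | f x = chi f]) cX.
- exact: closed_cfun_level.
- apply: contrapT => none.
  pose d (f : CX) : CX := (- chi f) *: (1 : CX) + f.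
  pose F : CX := \sum_(f <- s) d f * cfun_star (d f).
  have dE f x : d f x = f x - chi f.
    by rewrite /d cfunD cfunZ cfun1 mulr1 addrC.
  have chid f : chi (d f) = 0 by rewrite lin one mulr1 addNr.
  have chiF : chi F = 0.
    by rewrite /F chi_sum big1 // => f _; rewrite mul chid mul0r.
  have F0 x : F x != 0.
    apply/negP => /eqP; rewrite /F cfun_sum => /eqP.
    rewrite psumr_eq0 => [/allP h|f _]; last by rewrite cfunM mul_conjC_ge0.
    apply: none; exists x; split=> // f fs.
    have := h f fs; rewrite cfunM mul_conjC_eq0 dE subr_eq0.
    by move=> /eqP.
  have FV : F * CFun (cfun_inv_subproof F0) = 1.
    by apply: cfun_ext => x; rewrite cfunM cfun1 /= divff.
  have := mul F (CFun (cfun_inv_subproof F0)).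
  by rewrite FV one chiF mul0r => /eqP; rewrite oner_eq0.
- by exists x => f; rewrite -hx.
Qed.

End ComplexFunctions.

(** * Bounded functions as an operator system *)

Section BoundedFunctions.
Variables (R : realType) (W : Type).
Local Notation C := R[i].

Definition bounded_pred : {pred W -> C^o} :=
  fun F => `[< exists k : nat, forall w, `|F w : C| <= k%:R >].

Record bfun := BFun {
  bfun_val :> W -> C^o;
  bfun_valP : bfun_val \in bounded_pred }.

HB.instance Definition _ := [isSub for bfun_val].
HB.instance Definition _ := [Choice of bfun by <:].

Lemma bounded_zmod : zmod_closed bounded_pred.
Proof.
split=> [|F H /asboolP[k Fk] /asboolP[l Hl]]; apply/asboolP.
  by exists 0%N => w; rewrite normr0.
exists (k + l)%N => w; rewrite natrD.
exact: le_trans (ler_normB _ _) (lerD (Fk w) (Hl w)).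
Qed.

Lemma bounded_scaler : @GRing.scaler_closed C (W -> C^o) bounded_pred.
Proof.
move=> a F /asboolP[k Fk]; apply/asboolP.
exists (Num.bound (ComplexField.Normc.normc a) * k)%N => w.
have -> : `|(a *: F) w : C| = `|a| * `|F w : C| by exact: normrM.
rewrite natrM; apply: ler_pM => //.
rewrite [`|a|]/(real_complex R _) -(rmorph_nat (real_complex R)) lecR.
by apply/ltW/archi_boundP; case: (a) => u v; exact: sqrtr_ge0.
Qed.

HB.instance Definition _ := GRing.isZmodClosed.Build _ bounded_pred
  bounded_zmod.
HB.instance Definition _ := GRing.isScaleClosed.Build _ _ bounded_pred
  bounded_scaler.
HB.instance Definition _ :=
  GRing.SubChoice_isSubZmodule.Build _ _ bfun (zmodClosedP bounded_pred).
HB.instance Definition _ :=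
  GRing.SubZmodule_isSubLmodule.Build _ _ _ bfun
    (GRing.subsemimodClosedP bounded_pred).


Local Notation B := bfun.

Lemma bfun_ext (F H : B) : (forall w, F w = H w) -> F = H.
Proof. by move=> FH; apply/val_inj/funext. Qed.

Lemma bfunD (F H : B) w : (F + H) w = F w + H w.
Proof. by []. Qed.

Lemma bfunZ (a : C) (F : B) w : (a *: F) w = a * F w.
Proof. by []. Qed.

Lemma bfun_sum I (r : seq I) (P : pred I) (F : I -> B) w :
  (\sum_(i <- r | P i) F i) w = \sum_(i <- r | P i) F i w.
Proof. by elim/big_rec2: _ => // i y1 y2 _ <-. Qed.

Lemma bfun_cst_subproof (a : C) : (fun=> a : C^o) \in bounded_pred.
Proof.
apply/asboolP; exists (Num.bound (ComplexField.Normc.normc a)) => _.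
rewrite [`|_|]/(real_complex R _) -(rmorph_nat (real_complex R)) lecR.
by apply/ltW/archi_boundP; case: (a) => u v; exact: sqrtr_ge0.
Qed.

Definition bfun_one : B := BFun (bfun_cst_subproof 1).

Lemma bfun_star_subproof (F : B) :
  (fun w => conjC (F w) : C^o) \in bounded_pred.
Proof.
have /asboolP[k Fk] := bfun_valP F.
by apply/asboolP; exists k => w; rewrite norm_conjC.
Qed.

Definition bfun_star (F : B) : B := BFun (bfun_star_subproof F).

Definition bfun_eval n (F : 'M[B]_n) (w : W) : 'M[C]_n :=
  \matrix_(i, j) (F i j w : C).

Definition bfun_pos n : set 'M[B]_n :=
  [set F | forall w, psdmx (bfun_eval F w)].

Lemma bfun_evalD n (F H : 'M[B]_n) w :
  bfun_eval (F + H) w = bfun_eval F w + bfun_eval H w.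
Proof. by apply/matrixP => i j; rewrite !mxE. Qed.

Lemma bfun_eval_diag n (a : C) w :
  bfun_eval (diag_const n (a *: bfun_one)) w = a%:M.
Proof.
apply/matrixP => i j; rewrite !mxE; case: eqP => _ //.
exact: mulr1.
Qed.

Lemma bfun_eval_compress m n (A : 'M[C]_(m, n)) (F : 'M[B]_m) w :
  bfun_eval (compress A F) w = A ^t* *m bfun_eval F w *m A.
Proof.
apply/matrixP => i j; rewrite [LHS]mxE [in LHS]mxE bfun_sum.
rewrite (eq_bigr (fun k => \sum_l conjC (A k i) * A l j * F k l w)); last first.
  by move=> k _; rewrite bfun_sum.
rewrite exchange_big [RHS]mxE; apply: eq_bigr => l _; rewrite mxE mulr_suml.
by apply: eq_bigr => k _; rewrite trmxCE [bfun_eval _ _ _ _]mxE mulrAC.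
Qed.

Lemma bfun_eval_hermitian n (F : 'M[B]_n) :
  selfadjoint_mx bfun_star F <->
  forall w, (bfun_eval F w) ^t* = bfun_eval F w.
Proof.
split=> [hF w|hF i j].
  by apply/matrixP => i j; rewrite trmxCE !mxE -(hF j i).
apply: bfun_ext => w; have /matrixP/(_ j i) := hF w.
by rewrite trmxCE !mxE.
Qed.

Lemma bfun_starK : involutive bfun_star.
Proof. by move=> F; apply: bfun_ext => w; exact: conjCK. Qed.

Lemma bfun_starD (F H : B) : bfun_star (F + H) = bfun_star F + bfun_star H.
Proof. by apply: bfun_ext => w; rewrite bfunD; exact: rmorphD. Qed.

Lemma bfun_starZ (a : C) (F : B) :
  bfun_star (a *: F) = conjC a *: bfun_star F.
Proof. by apply: bfun_ext => w; rewrite bfunZ; exact: rmorphM. Qed.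

Lemma bfun_pos_selfadjoint n (F : 'M[B]_n) :
  bfun_pos F -> selfadjoint_mx bfun_star F.
Proof. by move=> pF; apply/bfun_eval_hermitian => w; case: (pF w). Qed.

Lemma bfun_pos0 n : bfun_pos (0 : 'M[B]_n).
Proof.
move=> w; have -> : bfun_eval (0 : 'M[B]_n) w = 0.
  by apply/matrixP => i j; rewrite !mxE.
exact: psdmx0.
Qed.

Lemma bfun_posD n (F H : 'M[B]_n) :
  bfun_pos F -> bfun_pos H -> bfun_pos (F + H).
Proof. by move=> pF pH w; rewrite bfun_evalD; exact: psdmxD. Qed.

Lemma bfun_pos_proper n (F : 'M[B]_n) : bfun_pos F -> bfun_pos (- F) -> F = 0.
Proof.
move=> pF nF; apply/matrixP => i j; rewrite mxE; apply: bfun_ext => w.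
have /matrixP/(_ i j) : bfun_eval F w = 0; last by rewrite !mxE.
apply: psdmx_proper (pF w) _.
suff -> : - bfun_eval F w = bfun_eval (- F) w by exact: nF.
by apply/matrixP => k l; rewrite !mxE.
Qed.

Lemma bfun_pos_compress m n (A : 'M[C]_(m, n)) (F : 'M[B]_m) :
  bfun_pos F -> bfun_pos (compress A F).
Proof. by move=> pF w; rewrite bfun_eval_compress; exact: psdmx_compress. Qed.

Lemma bfun_order_unit n (F : 'M[B]_n) : selfadjoint_mx bfun_star F ->
  exists2 a : C, 0 < a & bfun_pos (diag_const n (a *: bfun_one) + F).
Proof.
move=> /bfun_eval_hermitian hF.
have [k kF] : exists k : nat, forall i j w, `|F i j w : C| <= k%:R.
  have /choice[K KP] : forall ij : 'I_n * 'I_n, exists k : nat,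
      forall w, `|F ij.1 ij.2 w : C| <= k%:R.
    by move=> ij; exact/asboolP/(bfun_valP (F ij.1 ij.2)).
  exists (\max_ij K ij) => i j w; apply: le_trans (KP (i, j) w) _.
  by rewrite ler_nat; exact: (leq_bigmax (i, j)).
exists (k%:R *+ n *+ 2 + 1) => [|w].
  by rewrite ltr_wpDl// mulrn_wge0// mulrn_wge0.
rewrite bfun_evalD bfun_eval_diag raddfD /= addrAC addrC.
apply: psdmxD; first exact: psdmx1.
by apply: psdmx_bounded (hF w) _ => i j; rewrite mxE.
Qed.

Lemma bfun_archimedean n (F : 'M[B]_n) :
  (forall a : C, 0 < a -> bfun_pos (diag_const n (a *: bfun_one) + F)) ->
  bfun_pos F.
Proof.
move=> aF w; apply: psdmx_archimedean => a a0.
by have := aF a a0 w; rewrite bfun_evalD bfun_eval_diag.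
Qed.

Definition bfun_opsys : opsys R :=
  OpSys bfun_starK bfun_starD bfun_starZ bfun_pos_selfadjoint bfun_pos0
    bfun_posD bfun_pos_proper bfun_pos_compress bfun_order_unit
    bfun_archimedean.

End BoundedFunctions.

Section OrbitFunctions.
Variables (R : realType) (G : groupType) (X : Type).
Local Notation C := R[i].
Local Notation B := (bfun R (G * X)).

Lemma bfun_act_subproof (g : G) (F : B) :
  (fun w => F (g^-1 * w.1, w.2)%g : C^o) \in @bounded_pred R (G * X).
Proof.
have /asboolP[k Fk] := bfun_valP F.
by apply/asboolP; exists k => w; exact: Fk.
Qed.

(** G translates only the first coordinate, so G * X is a free G-set whatever
    the action on X; that action enters only through the maps into B. *)
Definition bfun_act (g : G) (F : B) : B := BFun (bfun_act_subproof g F).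

Lemma bfun_act1 F : bfun_act 1%g F = F.
Proof. by apply: bfun_ext => -[g x] /=; rewrite invg1 mul1g. Qed.

Lemma bfun_actM g h F : bfun_act (g * h)%g F = bfun_act g (bfun_act h F).
Proof. by apply: bfun_ext => -[k x] /=; rewrite invgM mulgA. Qed.

Lemma bfun_act_linear g : linear (bfun_act g).
Proof. by move=> a F H; apply: bfun_ext. Qed.

Lemma bfun_act_one g : bfun_act g (bfun_one R (G * X)) = bfun_one R (G * X).
Proof. exact: bfun_ext. Qed.

Lemma bfun_act_order g n (F : 'M[B]_n) :
  bfun_pos (map_mx (bfun_act g) F) <-> bfun_pos F.
Proof.
have E w : bfun_eval (map_mx (bfun_act g) F) w =
    bfun_eval F (g^-1 * w.1, w.2)%g.
  by apply/matrixP => i j; rewrite !mxE.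
split=> pF w; last by rewrite E.
by have := pF (g * w.1, w.2)%g; rewrite E /= mulKg -surjective_pairing.
Qed.

Definition orbit_gopsys : gopsys R G :=
  @GOpSys R G (bfun_opsys R (G * X)) bfun_act bfun_act1 bfun_actM
    bfun_act_linear bfun_act_one bfun_act_order.

End OrbitFunctions.

(** * States and Poisson maps *)

Section States.
Variables (R : realType) (X : topologicalType).
Local Notation C := R[i].
Local Notation CX := (cfun R X).

(** Compatibility with adjoints is a clause of its own: it supplies the hermitian
    half of [psdmx] when mu is applied to a matrix of functions. *)
Definition state (mu : CX -> C) :=
  [/\ forall (a : C) (f h : CX), mu (a *: f + h) = a * mu f + mu h,
      mu 1 = 1,
      forall f, mu (cfun_star f) = conjC (mu f) &
      forall f : CX, (forall x, 0 <= (f x : C)) -> 0 <= mu f].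

Lemma evaluation_state (x : X) : state (fun f => f x).
Proof. by split. Qed.

Lemma state0 mu : state mu -> mu 0 = 0.
Proof.
case=> lin _ _ _; have := lin (-1) 0 0.
by rewrite scaler0 addr0 mulN1r addNr.
Qed.

Lemma stateD mu (f h : CX) : state mu -> mu (f + h) = mu f + mu h.
Proof. by case=> lin _ _ _; have := lin 1 f h; rewrite scale1r mul1r. Qed.

Lemma stateZ mu (a : C) (f : CX) : state mu -> mu (a *: f) = a * mu f.
Proof.
move=> smu; have [lin _ _ _] := smu.
by have := lin a f 0; rewrite !addr0 (state0 smu) addr0.
Qed.

Lemma state_sum mu I (r : seq I) (F : I -> CX) : state mu ->
  mu (\sum_(i <- r) F i) = \sum_(i <- r) mu (F i).
Proof.
move=> smu; elim/big_rec2: _ => [|i y1 y2 _ <-]; first exact: state0.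
exact: stateD.
Qed.

(** Positive functionals on a commutative C*-algebra are completely positive:
    v^* mu(F) v is the value of mu at the pointwise quadratic form v^* F v. *)
Lemma state_psdmx mu n (F : 'M[CX]_n) : state mu -> cfun_pos F ->
  psdmx (\matrix_(i, j) mu (F i j)).
Proof.
move=> smu pF; have [_ _ star pos] := smu.
split=> [|v].
  apply/matrixP => i j; rewrite trmxCE !mxE -star; congr mu.
  exact: (cfun_pos_selfadjoint pF).
rewrite quad_formE.
pose q : CX := \sum_i \sum_j (conjC (v i 0) * v j 0) *: F i j.
suff -> : \sum_i \sum_j conjC (v i 0) * (\matrix_(i, j) mu (F i j)) i j * v j 0
    = mu q.
  apply: pos => x; have [_ /(_ v)] := pF x; rewrite quad_formE.
  congr (_ <= _); rewrite /q cfun_sum; apply: eq_bigr => i _.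
  rewrite cfun_sum; apply: eq_bigr => j _.
  by rewrite mxE cfunZ mulrAC.
rewrite /q state_sum //; apply: eq_bigr => i _.
rewrite state_sum //; apply: eq_bigr => j _.
by rewrite mxE stateZ // mulrAC.
Qed.

Lemma cfun_le_state mu (f h : CX) : state mu ->
  (forall x, (f x : C) <= h x) -> mu f <= mu h.
Proof.
move=> smu fh; have [_ _ _ pos] := smu; rewrite -subr_ge0.
have -> : mu h - mu f = mu (h + (-1) *: f).
  by rewrite stateD // stateZ // mulN1r.
by apply: pos => x; rewrite cfunD cfunZ mulN1r subr_ge0.
Qed.

Lemma state_norm_selfadjoint mu (f : CX) (k : nat) : state mu ->
  cfun_star f = f -> (forall x, `|f x : C| <= k%:R) -> `|mu f| <= k%:R.
Proof.
move=> smu sf fk; have [_ one star _] := smu.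
have rf x : (f x : C) \is Num.real.
  by apply/CrealP; have := congr1 (fun h : CX => h x) sf.
have rmu : mu f \is Num.real by apply/CrealP; rewrite -star sf.
rewrite real_ler_norml //.
have kE (a : C) : mu (a *: (1 : CX)) = a by rewrite stateZ // one mulr1.
rewrite -{1}(kE (- k%:R)) -{2}(kE k%:R).
by apply/andP; split; apply: cfun_le_state => // x; have := fk x;
  rewrite real_ler_norml // cfunZ cfun1 mulr1 => /andP[].
Qed.

(** Splitting f into its selfadjoint and skew parts costs a factor 2, which is
    harmless: only a bound uniform over all states is wanted. *)
Lemma state_norm mu (f : CX) (k : nat) : state mu ->
  (forall x, `|f x : C| <= k%:R) -> `|mu f| <= (k + k)%:R.
Proof.
move=> smu fk.
have ni : `|'i : C| = 1 by exact: normCi.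
pose u : CX := 2^-1 *: (f + cfun_star f).
pose v : CX := ('i * 2^-1) *: (f - cfun_star f).
have half (a b : C) : `|a| <= k%:R -> `|b| <= k%:R -> `|2^-1 * (a + b)| <= k%:R.
  move=> ak bk; rewrite normrM (@ger0_norm _ 2^-1) ?invr_ge0 ?ler0n //.
  rewrite ler_pdivrMl ?ltr0n //.
  by apply: le_trans (ler_normD _ _) _; rewrite mulr2n mulrDl !mul1r lerD.
have uE x : u x = 2^-1 * ((f x : C) + conjC (f x)) by [].
have vE x : v x = 'i * 2^-1 * ((f x : C) - conjC (f x)) by [].
have starE (h : CX) x : cfun_star h x = conjC (h x) by [].
have c2 : conjC (2^-1 : C) = 2^-1 by rewrite fmorphV rmorph_nat.
have uk : `|mu u| <= k%:R.
  apply: state_norm_selfadjoint => // [|x].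
    apply: cfun_ext => x; rewrite starE uE.
    by rewrite rmorphM rmorphD /= conjCK c2 addrC.
  by rewrite uE half // norm_conjC.
have vk : `|mu v| <= k%:R.
  apply: state_norm_selfadjoint => // [|x].
    apply: cfun_ext => x; rewrite starE vE.
    rewrite rmorphM rmorphB /= conjCK rmorphM /= conjCi c2.
    by rewrite mulNr mulNr -mulrN opprB.
  by rewrite vE -mulrA normrM ni mul1r half // normrN norm_conjC.
have -> : f = u + (- 'i) *: v.
  apply: cfun_ext => x.
  have -> : (u + (- 'i) *: v) x = u x + (- 'i) * v x by [].
  rewrite uE vE !mulrA mulNr -expr2 sqrCi opprK mul1r -mulrDr.
  rewrite addrACA subrr addr0 -mulr2n -[X in _ * X]mulr_natl mulrA.
  by rewrite mulVf ?mul1r ?pnatr_eq0.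
rewrite (stateD u _ smu) (stateZ _ v smu) natrD.
by apply: le_trans (ler_normD _ _) _; rewrite normrM normrN ni mul1r lerD.
Qed.

End States.

Lemma psdmx1P (C : numClosedFieldType) (M : 'M[C]_1) :
  psdmx M <-> 0 <= M 0 0.
Proof.
split=> [[_ /(_ 1%:M)]|M0].
  by rewrite quad_formE !big_ord1 !mxE eqxx conjC1 mul1r mulr1.
have eM : M = (M 0 0)%:M.
  by apply/matrixP => i j; rewrite !ord1 !mxE eqxx mulr1n.
split=> [|v].
  rewrite eM tr_scalar_mx map_scalar_mx /=; congr _%:M.
  exact/CrealP/ger0_real.
rewrite quad_formE !big_ord1 mulrAC mulrC mulr_ge0 //.
by rewrite mulrC mul_conjC_ge0.
Qed.

Lemma gmorphism_comp (R : realType) (G : groupType) (U V W : gopsys R G)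
  (phi : U -> V) (psi : V -> W) :
  gmorphism phi -> gmorphism psi -> gmorphism (psi \o phi).
Proof.
move=> [pl p1 pcp pe] [ql q1 qcp qe]; split.
- by move=> a x y /=; rewrite pl ql.
- by rewrite /= p1 q1.
- by move=> n F /pcp/qcp; rewrite -map_mx_comp.
- by move=> g x; rewrite /= pe qe.
Qed.

Section GmorphismLinear.
Variables (R : realType) (G : groupType) (V W : gopsys R G) (phi : V -> W).
Hypothesis phiM : gmorphism phi.

Lemma gmorphism0 : phi 0 = 0.
Proof.
have [lin _ _ _] := phiM; have := lin (-1) 0 0.
by rewrite scaler0 addr0 scaleN1r addNr.
Qed.

Lemma gmorphismZ (a : R[i]) (x : V) : phi (a *: x) = a *: phi x.
Proof.
have [lin _ _ _] := phiM; have := lin a x 0.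
by rewrite gmorphism0 !addr0.
Qed.

End GmorphismLinear.

Section PoissonMap.
Variables (R : realType) (G : groupType) (X : Type) (Z : compact_gspace G).
Local Notation C := R[i].
Local Notation CZ := (cfun R Z).
Variable mu : X -> CZ -> C.
Hypothesis smu : forall x, state (mu x).

Lemma poisson_map_subproof (f : CZ) :
  (fun w => mu w.2 (cfun_act w.1^-1%g f) : C^o) \in @bounded_pred R (G * X).
Proof.
have [k fk] := cfun_bounded (@gs_compact G Z) f.
apply/asboolP; exists (k + k)%N => w.
by apply: state_norm => // z; exact: fk.
Qed.

(** The Poisson transform of a family of states: w = (g, x) is sent to the
    value at f of the translated state g mu_x, which makes the map equivariant
    for any family whatsoever. *)
Definition poisson_map (f : CX_gopsys R Z) : orbit_gopsys R G X :=
  BFun (poisson_map_subproof f).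

Lemma poisson_mapE f w : (poisson_map f : bfun R (G * X)) w
  = mu w.2 (cfun_act w.1^-1%g f).
Proof. by []. Qed.

Lemma poisson_map_gmorphism : gmorphism poisson_map.
Proof.
split.
- move=> a f h; apply: bfun_ext => w /=.
  rewrite cfun_act_linear; have [lin _ _ _] := smu w.2.
  exact: lin.
- apply: bfun_ext => w /=; rewrite cfun_act_one.
  by have [_ one _ _] := smu w.2.
- move=> n F pF w.
  have := state_psdmx (smu w.2) ((cfun_act_order w.1^-1%g F).2 pF).
  by congr psdmx; apply/matrixP => i j; rewrite !mxE.
- move=> g f; apply: bfun_ext => -[h x] /=.
  by rewrite -cfun_actM invgM invgK.
Qed.

End PoissonMap.

Lemma bounded_funP (R : realType) (T : Type) (f : T -> R^o) :
  bounded_fun f <-> exists k : nat, forall x, `|f x| <= k%:R.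
Proof.
split=> [[M [_ fM]]|[k fk]].
  exists (Num.bound `|M + 1|) => x.
  apply: le_trans (fM (M + 1) _ x I) _; first by rewrite ltrDl.
  exact/ltW/(le_lt_trans (ler_norm _))/archi_boundP/normr_ge0.
exists k%:R; split; first exact: num_real.
by move=> M kM x _; exact: le_trans (fk x) (ltW kM).
Qed.

Lemma bounded_fun_linear (R : realType) (T : Type) (a : R) (f g : T -> R^o) :
  bounded_fun f -> bounded_fun g -> bounded_fun (a *: f + g).
Proof.
move=> /bounded_funP[k fk] /bounded_funP[j gj]; apply/bounded_funP.
exists (Num.bound `|a| * k + j)%N => x; rewrite natrD natrM.
apply: le_trans (ler_normD _ _) _; apply: lerD; last exact: gj.
have -> : `|(a *: f) x| = `|a| * `|f x| by exact: normrM.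
by apply: ler_pM => //; exact/ltW/archi_boundP/normr_ge0.
Qed.

Lemma normc_ge_Im (R : realType) (z : R[i]) : `|complex.Im z|%:C <= `|z|.
Proof.
case: z => u v.
by rewrite normc_def lecR -sqrtr_sqr ler_wsqrtr // lerDr sqr_ge0.
Qed.

(** With r g a representative of the right coset K g, put l g = g (r g)^-1. *)
Lemma equivariant_projection (G : groupType) (K : subgroup G) :
  exists l : G -> sg_type K,
    forall (h : sg_type K) g, l (val h * g)%g = (h * l g)%g.
Proof.
pose coset (g : G) := [set g' | exists h : sg_type K, g' = (val h * g)%g].
pose r g := xget 1%g (coset g).
have cosetM (h : sg_type K) g : coset (val h * g)%g = coset g.
  apply/seteqP; split=> g' [k ->].
    by exists (k * h)%g; rewrite mulgA.
  by exists (k * h^-1)%g; rewrite mulgA -[(_ * val h)%g]mulgA mulVg mulg1.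
have rM (h : sg_type K) g : r (val h * g)%g = r g by rewrite /r cosetM.
have rK g : sg_mem K (g * (r g)^-1)%g.
  have [h ->] : exists h : sg_type K, r g = (val h * g)%g.
    suff : coset g (r g) by [].
    by apply: xgetPex; exists g, 1%g; rewrite mul1g.
  by rewrite invgM mulgA mulgV mul1g; exact: (valP h^-1%g).
exists (fun g => exist (fun x => is_true (sg_mem K x)) _ (rK g)) => h g.
by apply: val_inj => /=; rewrite rM mulgA.
Qed.

(** * The injective envelope *)

Section Envelope.
Variables (R : realType) (G : groupType) (X Y : compact_gspace G).
Local Notation C := R[i].
Local Notation CX := (cfun R X).
Local Notation CY := (cfun R Y).
Variable iota : CX_gopsys R X -> CX_gopsys R Y.
Hypothesis iota_env : is_ginjective_envelope iota.

(** The space map dual to the inclusion of C(X) into C(Y).  It is onto because a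
    bump function off its compact image would be killed by iota. *)
Lemma dual_map : exists p : Y -> X,
  [/\ forall (f : CX) y, (iota f : CY) y = f (p y), continuous p,
      forall g y, p (gs_act g y) = gs_act g (p y) &
      forall x, exists y, p y = x].
Proof.
have [_ [lin one mul star [inj eqv]] _] := iota_env.
have /choice[p pE] : forall y : Y, exists x : X, forall f : CX,
    (iota f : CY) y = f x.
  move=> y.
  apply: (@character_is_evaluation R X (fun f => (iota f : CY) y)
    (@gs_compact G X)).
  - by move=> a f h; rewrite lin.
  - by rewrite one.
  - by move=> f h; rewrite mul.
have cp : continuous p.
  move=> y A /= nA.
  have [f [fy _ f0]] := cfun_urysohn R (@gs_compact G X) (@gs_hausdorff G X)
    (@open_interior _ A) nA.
  have oV : open (~` [set z : Y | (iota f : CY) z = 0]).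
    by apply: closed_openC; exact: closed_cfun_level.
  have Vy : (~` [set z : Y | (iota f : CY) z = 0]) y.
    by rewrite /= pE fy; apply/eqP; exact: oner_neq0.
  apply: filterS (open_nbhs_nbhs (conj oV Vy)) => z /= nz.
  apply: contrapT => nAz; apply: nz; rewrite pE; apply: f0 => Az.
  by apply: nAz; exact: interior_subset.
have sep (x x' : X) : (forall f : CX, f x = f x') -> x = x'.
  move=> ff; apply: contrapT => xx'.
  have oV : open (~` [set x']).
    apply: closed_openC; apply: accessible_closed_set1.
    exact/hausdorff_accessible/gs_hausdorff.
  have [f [fx _ f0]] := cfun_urysohn R (@gs_compact G X) (@gs_hausdorff G X)
    oV xx'.
  have := ff f; rewrite fx f0 => [/eqP|/(_ erefl) //]; by rewrite oner_eq0.
exists p; split=> //.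
- move=> g y; apply: sep => f.
  have := congr1 (fun h : CY => h y) (eqv g^-1%g f).
  by rewrite pE /= invgK pE.
- move=> x; apply: contrapT => nx.
  have cI : closed (p @` setT).
    apply: compact_closed; first exact: gs_hausdorff.
    apply: continuous_compact; last exact: gs_compact.
    exact: continuous_subspaceT.
  have Vx : (~` (p @` setT)) x by move=> [y _ yx]; apply: nx; exists y.
  have [f [fx _ f0]] := cfun_urysohn R (@gs_compact G X) (@gs_hausdorff G X)
    (closed_openC cI) Vx.
  have : f = 0.
    apply: inj; apply: cfun_ext => y; rewrite !pE f0 ?cfun0 //.
    by apply; exists y.
  by move=> f00; move: fx; rewrite f00 cfun0 => /esym/eqP; rewrite oner_eq0.
Qed.

Lemma iota_gmorphism : gmorphism iota.
Proof.
have [_ [lin one _ _ [_ eqv]] _] := iota_env; have [p [pE _ _ _]] := dual_map.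
split=> // n F pF y.
by have := pF (p y); congr psdmx; apply/matrixP => i j; rewrite !mxE pE.
Qed.

(** For point masses the Poisson map is f |-> ((g, x) |-> f(g x)). *)
Definition orbit_map : CX_gopsys R X -> orbit_gopsys R G X :=
  poisson_map (@evaluation_state R X).

(** The pairs (1, x) already see every point of X, so the matrix order of C(X)
    is the induced one. *)
Lemma orbit_map_gsubsystem : gsubsystem orbit_map.
Proof.
split=> [|n F pF x]; first exact: poisson_map_gmorphism.
have := pF (1%g, x); congr psdmx; apply/matrixP => i j; rewrite !mxE /=.
by rewrite !invg1 gs_act1.
Qed.

(** Injectivity gives psi, and rigidity turns it into a retraction of every
    map of C(Y) into functions on G x X that is built from states of C(Y)
    sitting over the points of X.  Both halves of the comparison of stability
    systems come from a suitable choice of these states. *)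
Lemma orbit_retraction : exists psi : orbit_gopsys R G X -> CX_gopsys R Y,
  gmorphism psi /\
  forall (mu : X -> CY -> C) (smu : forall x, state (mu x)),
    (forall x (f : CX), mu x (iota f) = f x) ->
    forall f, psi (poisson_map smu f) = f.
Proof.
have [inj [_ _ _ _ [_ eqv]] rigid] := iota_env.
have [psi psiM psiE] := inj _ _ _ _ orbit_map_gsubsystem iota_gmorphism.
exists psi; split=> // mu smu muE f.
have tM := gmorphism_comp (poisson_map_gmorphism smu) psiM.
suff /(rigid _ tM)/(congr1 (fun F : CY -> CY => F f)) :
    forall h, (psi \o poisson_map smu) (iota h) = iota h by [].
move=> h; rewrite -[RHS]psiE /=; congr psi; apply: bfun_ext => w.
have e : iota (cfun_act w.1^-1%g h) = cfun_act w.1^-1%g (iota h) := eqv _ _.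
by rewrite !poisson_mapE -e muE.
Qed.

Lemma gmorphism_ge0 (psi : orbit_gopsys R G X -> CX_gopsys R Y) :
  gmorphism psi -> forall F : bfun R (G * X), (forall w, 0 <= (F w : C)) ->
  forall y, 0 <= ((psi F : CY) y : C).
Proof.
move=> [_ _ cp _] F F0 y.
have pF : bfun_pos (const_mx F : 'M[bfun R (G * X)]_1).
  by move=> w; apply/psdmx1P; rewrite !mxE.
by have /psdmx1P := cp 1%N (const_mx F) pF y; rewrite !mxE.
Qed.

Lemma separating_nbhs (y : Y) (s : seq G) : exists V : set Y,
  [/\ open V, V y & forall t, t \in s -> gs_act t y <> y ->
      forall z, V z -> ~ V (gs_act t z)].
Proof.
elim: s => [|t s [V [oV Vy sV]]].
  by exists setT; split=> //; exact: openT.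
have [ty|ty] := pselect (gs_act t y = y).
  exists V; split=> // u; rewrite inE => /orP[/eqP ->|]; first by [].
  exact: sV.
have [U [oU Uy tU]] := moved_nbhs ty.
exists (V `&` U); split=> //; first exact: openI.
move=> u; rewrite inE.
move=> /orP[/eqP -> _ z [_ Uz] [_ Utz]|us uy z [Vz _] [Vuz _]].
  exact: tU Utz.
exact: sV Vuz.
Qed.

(** Let f be a bump at y whose support is disjoint from its translates by the
    elements t of s that move y.  A state invariant under such a t gives f
    mass at most 1/2; were there one for every point of G x X, the retraction
    would give f(y) <= 1/2. *)
Lemma invariant_states_avoid (H : X -> subgroup G) (mu : X -> CY -> C) :
  (forall x, state (mu x)) -> (forall x (f : CX), mu x (iota f) = f x) ->
  (forall x h f, sg_mem (H x) h -> mu x (cfun_act h f) = mu x f) ->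
  forall (y : Y) (s : seq G), exists g x, forall t, t \in s ->
    gs_act t y <> y -> ~~ sg_mem (sg_conj g (H x)) t.
Proof.
move=> smu muE muH y s; apply: contrapT => none.
have [psi [psiM psiE]] := orbit_retraction.
have [V [oV Vy sV]] := separating_nbhs y s.
have [f [fy f01 f0]] :=
  cfun_urysohn R (@gs_compact G Y) (@gs_hausdorff G Y) oV Vy.
have small w : (poisson_map smu f : bfun R (G * X)) w <= 2^-1.
  case: w => g x; rewrite poisson_mapE /=; set m := mu x _.
  have [t [ts ty tH]] : exists t, [/\ t \in s, gs_act t y <> y &
      sg_mem (sg_conj g (H x)) t].
    apply: contrapT => nt; apply: none; exists g, x => t ts ty.
    by apply/negP => tH; apply: nt; exists t.
  have mt : mu x (cfun_act g^-1%g (cfun_act t f)) = m.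
    rewrite -[RHS](muH x (t ^ g)%g) // -!cfun_actM conjgE.
    by rewrite !mulgA mulgK.
  rewrite -[leLHS]mul1r -(@ler_pM2l _ 2) // mulrA mulr1 mulfV ?pnatr_eq0 //.
  have -> : 2 * m = mu x (cfun_act g^-1%g (f + cfun_act t f)).
    rewrite mulr_natl mulr2n -{2}mt -stateD //.
    by congr (mu x _); exact: cfun_ext.
  have [_ one _ _] := smu x; rewrite -one; apply: cfun_le_state => // z.
  rewrite [leRHS]cfun1.
  have /andP[_ a1] := f01 (gs_act g z).
  have /andP[_ b1] := f01 (gs_act t^-1%g (gs_act g z)).
  have -> : cfun_act g^-1%g (f + cfun_act t f) z =
      f (gs_act g z) + f (gs_act t^-1%g (gs_act g z)) by rewrite /= invgK.
  have [Vz|nVz] := pselect (V (gs_act g z)); last by rewrite f0 // add0r.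
  rewrite [X in _ + X]f0 ?addr0 //.
  by move=> Vtz; apply: (sV t ts ty _ Vtz); rewrite gs_actVK.
have [lin one _ _] := psiM.
pose E := (-1) *: poisson_map smu f + 2^-1 *: os_one (orbit_gopsys R G X).
have E0 w : 0 <= ((E : bfun R (G * X)) w : C).
  have -> : (E : bfun R (G * X)) w =
      2^-1 - (poisson_map smu f : bfun R (G * X)) w.
    by rewrite bfunD !bfunZ mulN1r mulr1 addrC.
  by rewrite subr_ge0.
have := gmorphism_ge0 psiM E0 y.
have -> : psi E = (-1) *: f + 2^-1 *: os_one (CX_gopsys R Y).
  by rewrite lin psiE // (gmorphismZ psiM) one.
suff -> : (((-1) *: f + 2^-1 *: (1 : CY) : CY) y : C) = - 2^-1.
  by rewrite oppr_ge0 invr_le0 lern0.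
by rewrite cfunD !cfunZ cfun1 fy; field.
Qed.

(** If t_1, ..., t_n fix a neighbourhood W of y, then by rigidity Y cannot be
    cut down to the complement Y' of the orbit of W: point masses on Y' over all
    points of X would give a retraction that kills the bump functions on W.
    Hence some open set of points of X has all its fibres meeting the orbit of
    W, so it contains a generic point, which can be moved to one below W, where
    it is fixed by t_1, ..., t_n. *)
Lemma generic_stab_below (y : Y) : countable [set: G] -> generic y ->
  exists L, stability_system X L /\ sg_le (stab y) L.
Proof.
move=> cG /genericP gy; have [p [pE cp peq psurj]] := dual_map.
have [s|L [SL yL _]] := subgroup_compactness
    (P := [set t | sg_mem (stab y) t]) (N := set0)
    (@closed_stability_system G X); last by exists L.
pose W := [set z : Y | forall t, t \in s -> gs_act t y = y -> gs_act t z = z]°.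
have Wy : W y.
  rewrite /W; elim: s {W} => [|t s IH]; first exact: nearW.
  have [ty|ty] := pselect (gs_act t y = y); last first.
    apply: filterS IH => z zs u; rewrite inE => /orP[/eqP -> //|]; exact: zs.
  apply: filterS2 (gy t ty) IH => z zt zs u.
  by rewrite inE => /orP[/eqP -> //|]; exact: zs.
have oW : open W by exact: open_interior.
pose Y' := [set z : Y | forall g, ~ W (gs_act g z)].
have clY' : closed Y'.
  have -> : Y' = \bigcap_(g in setT) (gs_act g @^-1` (~` W)).
    by apply/seteqP; split=> z h g; [move=> _; exact: h|exact: (h g I)].
  apply: closed_bigI => g _; apply: closed_comp; last exact: open_closedC.
  by move=> z _; exact: gs_act_continuous.
have [x0 x0Y'] : exists x0, ~ exists z, Y' z /\ p z = x0.
  apply: contrapT => all; have /choice[sec secP] : forall x, exists z,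
      Y' z /\ p z = x.
    by move=> x; apply: contrapT => nx; apply: all; exists x.
  have [psi [psiM psiE]] := orbit_retraction.
  have [f [fy _ f0]] :=
    cfun_urysohn R (@gs_compact G Y) (@gs_hausdorff G Y) oW Wy.
  have := psiE (fun x h => h (sec x)) (fun x => evaluation_state R (sec x)).
  have secE x (h : CX) : (iota h : CY) (sec x) = h x.
    by rewrite pE (secP x).2.
  move=> /(_ secE f).
  have -> : poisson_map (fun x => evaluation_state R (sec x)) f = 0.
    apply: bfun_ext => -[g x] /=; rewrite invgK f0 //.
    exact: (secP x).1.
  rewrite (gmorphism0 psiM).
  move=> /(congr1 (fun h : CY => h y)); rewrite fy cfun0 => /esym/eqP.
  by rewrite oner_eq0.
have clpY' : closed (p @` Y').
  apply: compact_closed; first exact: gs_hausdorff.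
  apply: continuous_compact; first exact: continuous_subspaceT.
  by apply: subclosed_compact clY' (@gs_compact G Y) _.
have nx0 : (~` (p @` Y')) x0 by move=> [z Yz pz]; apply: x0Y'; exists z.
have [x [nx gx]] :=
  generic_near cG (open_nbhs_nbhs (conj (closed_openC clpY') nx0)).
have [y1 y1x] := psurj x.
have [g Wg] : exists g, W (gs_act g y1).
  apply: contrapT => nW; apply: nx; exists y1 => // g Wg; apply: nW.
  by exists g.
exists (stab (gs_act g x)); split=> //.
  exact/stab_in_stability_system/generic_act.
move=> t ts /stabP ty; apply/stabP; rewrite -y1x -!peq.
by congr p; exact: (interior_subset Wg).
Qed.

(** A bounded function on K extends to G along a map from G to K that commutes
    with left translation by K, so a point fixed by K turns the retraction onto
    C(Y) into an invariant mean on K. *)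
Lemma amenable_sub_stab (K : subgroup G) (y : Y) : sg_le K (stab y) ->
  amenable R (sg_type K).
Proof.
move=> Ky; have [psi [psiM _]] := orbit_retraction.
have [lin one _ eqv] := psiM.
have [l lK] := equivariant_projection K.
pose lift (f : sg_type K -> R^o) : bfun R (G * X) :=
  insubd (0 : bfun R (G * X)) (fun w : G * X => (f (l w.1))%:C : C^o).
have liftE f : bounded_fun f -> forall w, lift f w = (f (l w.1))%:C.
  move=> /bounded_funP[k fk] w; rewrite /lift /insubd insubT //.
  apply/asboolP; exists k => v.
  rewrite normc_def /= expr0n addr0 sqrtr_sqr.
  by rewrite -(rmorph_nat (real_complex R)) lecR.
exists (fun f => complex.Re ((psi (lift f) : CY) y)); split.
- move=> a f g bf bg.
  have bfg := bounded_fun_linear a bf bg.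
  have -> : lift (a *: f + g) = a%:C *: lift f + lift g.
    apply: bfun_ext => w; rewrite bfunD bfunZ !liftE //.
    by rewrite -rmorphM -rmorphD.
  rewrite lin; set z := psi _; set w := psi _.
  rewrite cfunD cfunZ raddfD /=.
  by case: (z y) => u v /=; rewrite mul0r subr0.
- have b1 : bounded_fun (cst 1 : sg_type K -> R^o).
    by apply/bounded_funP; exists 1%N => h; rewrite normr1.
  have -> : lift (cst 1) = os_one (orbit_gopsys R G X).
    by apply: bfun_ext => w; rewrite liftE.
  by rewrite one cfun1.
- move=> f bf f0.
  have : 0 <= ((psi (lift f) : CY) y : C).
    by apply: gmorphism_ge0 => // w; rewrite liftE // ler0c.
  by case: (_ y) => u v; rewrite lecE /= => /andP[].
- move=> h f bf.
  have bfh : bounded_fun (fun x => f (h * x)%g).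
    by move/bounded_funP: bf => [k fk]; apply/bounded_funP; exists k.
  have -> : lift (fun x => f (h * x)%g) = bfun_act (val h)^-1%g (lift f).
    by apply: bfun_ext => w /=; rewrite !liftE //= invgK lK.
  have -> : psi (bfun_act (val h)^-1%g (lift f)) =
      cfun_act (val h)^-1%g (psi (lift f)) := eqv _ _.
  rewrite /= invgK; congr (complex.Re ((psi (lift f) : CY) _)).
  by apply/stabP/Ky; exact: valP.
Qed.

(** Average the point masses at h y over h in H, where y is a point of Y above
    x; the orbit H y stays above x because H fixes x.  The mean is real, so real
    and imaginary parts are averaged separately. *)
Lemma invariant_state (H : subgroup G) (x : X) :
  amenable R (sg_type H) -> sg_le H (stab x) ->
  exists mu : CY -> C, [/\ state mu, forall f : CX, mu (iota f) = f x &
    forall h f, sg_mem H h -> mu (cfun_act h f) = mu f].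
Proof.
move=> [m [lin one pos inv]] Hx.
have [p [pE cp peq psurj]] := dual_map; have [y yx] := psurj x.
pose re (f : CY) (h : sg_type H) : R^o := complex.Re (f (gs_act (val h) y) : C).
pose im (f : CY) (h : sg_type H) : R^o := complex.Im (f (gs_act (val h) y) : C).
have bre f : bounded_fun (re f).
  have [k fk] := cfun_bounded (@gs_compact G Y) f.
  apply/bounded_funP; exists k => h.
  have := le_trans (normc_ge_Re _) (fk (gs_act (val h) y)).
  by rewrite -(rmorph_nat (real_complex R)) lecR.
have bim f : bounded_fun (im f).
  have [k fk] := cfun_bounded (@gs_compact G Y) f.
  apply/bounded_funP; exists k => h.
  have := le_trans (normc_ge_Im _) (fk (gs_act (val h) y)).
  by rewrite -(rmorph_nat (real_complex R)) lecR.
have b0 : bounded_fun (0 : sg_type H -> R^o).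
  by apply/bounded_funP; exists 0%N => h; rewrite normr0.
have b1 : bounded_fun (cst 1 : sg_type H -> R^o).
  by apply/bounded_funP; exists 1%N => h; rewrite normr1.
have m0 : m 0 = 0.
  by have := lin (-1) 0 0 b0 b0; rewrite scaler0 addr0 mulN1r addNr.
have mZ a f : bounded_fun f -> m (a *: f) = a * m f.
  by move=> bf; have := lin a f 0 bf b0; rewrite !addr0 m0 addr0.
have linE (a b : R) (F1 F2 F3 : sg_type H -> R^o) k :
  (a *: F1 + (b *: F2 + F3)) k = a * F1 k + (b * F2 k + F3 k) by [].
exists (fun f => (m (re f) +i* m (im f))%C); split.
- split.
  + move=> a f h.
    have -> : re (a *: f + h) =
        complex.Re a *: re f + ((- complex.Im a) *: im f + re h).
      apply: funext => k; rewrite linE /re /im cfunD cfunZ raddfD /=.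
      by case: a (f _) => u v [u' v'] /=; rewrite addrA mulNr.
    have -> : im (a *: f + h) =
        complex.Re a *: im f + (complex.Im a *: re f + im h).
      apply: funext => k; rewrite linE /re /im cfunD cfunZ raddfD /=.
      by case: a (f _) => u v [u' v'] /=; rewrite addrA.
    rewrite !lin //; try exact: bounded_fun_linear.
    by case: a => u v /=; simpc; congr (_ +i* _)%C; ring.
  + have -> : re 1 = cst 1 by [].
    have -> : im 1 = 0 by [].
    by rewrite one m0.
  + move=> f.
    have -> : re (cfun_star f) = re f.
      by apply: funext => k; rewrite /re /=; case: (f _).
    have -> : im (cfun_star f) = (-1) *: im f.
      apply: funext => k; rewrite scaleN1r -[RHS]/(- im f k) /im /=.
      by case: (f _).
    by rewrite mZ // mulN1r.
  + move=> f f0.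
    have -> : im f = 0.
      apply: funext => k; rewrite /im.
      have := f0 (gs_act (val k) y); case: (f _) => u v.
      by rewrite lecE /= => /andP[/eqP].
    rewrite m0 lecE /= eqxx /=; apply: pos => // k.
    by have := f0 (gs_act (val k) y); rewrite /re; case: (f _) => u v;
      rewrite lecE /= => /andP[].
- move=> f.
  have fE (h : sg_type H) : (iota f : CY) (gs_act (val h) y) = f x.
    by rewrite pE peq yx; congr (f _); apply/stabP/Hx; exact: valP.
  have -> : re (iota f) = complex.Re (f x) *: cst 1.
    by apply: funext => k; rewrite /re fE; exact/esym/mulr1.
  have -> : im (iota f) = complex.Im (f x) *: cst 1.
    by apply: funext => k; rewrite /im fE; exact/esym/mulr1.
  by rewrite !mZ // one !mulr1; case: (f x).
- move=> h f Hh; pose k : sg_type H := exist _ h Hh.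
  rewrite -(inv k^-1%g (re f)) // -(inv k^-1%g (im f)) //.
  by congr (m _ +i* m _)%C; apply: funext => j; rewrite /re /im /= gs_actM.
Qed.

(** H_x is chosen in U inside each stab x, and mu_x is an H_x-invariant state
    over x; the conjugates of the H_x lie in U and avoid any given finite set
    outside stab y, so a limit of them lies in stab y. *)
Lemma amenable_URS_below_stab (U : set (subgroup G)) (y : Y) :
  countable [set: G] ->
  amenable_URS R U -> is_URS (stability_system X) ->
  urs_le U (stability_system X) -> exists H, U H /\ sg_le H (stab y).
Proof.
move=> cG [uU aU] uS US; have [[cU _ iU] _] := uU.
have /choice[H HP] : forall x : X, exists H, U H /\ sg_le H (stab x).
  move=> x; have [K [SK Kx]] := stability_system_sub_stab x cG.
  have [H [UH HK]] := urs_le_sub uU.1 uS US SK.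
  by exists H; split=> //; exact: sg_le_trans Kx.
have /choice[mu muP] := fun x =>
  invariant_state (aU _ (HP x).1) (HP x).2.
have [s|L [UL _ yL]] := subgroup_compactness (P := set0)
    (N := [set t | ~~ sg_mem (stab y) t]) cU.
  have [x|x|x|g [x avoid]] := @invariant_states_avoid H mu _ _ _ y s.
  - by case: (muP x).
  - by case: (muP x).
  - by case: (muP x).
  exists (sg_conj g (H x)); split=> //; first exact/iU/(HP x).1.
  move=> t ts /= nty; apply: avoid => // /stabP ty.
  by move/negP: nty; apply.
by exists L; split=> // t Lt; apply/negPn/negP => /yL; rewrite Lt.
Qed.

End Envelope.

(** * The largest amenable uniformly recurrent subgroup *)

Theorem theorem1p8 (R : realType) (G : groupType)
  (G_countable : countable [set: G])
  (X Xt : compact_gspace G)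
  (iota : CX_gopsys R X -> CX_gopsys R Xt)
  (Xt_envelope : is_ginjective_envelope iota)
  (SX_urs : is_URS (stability_system X)) :
  exists A : set (subgroup G),
    [/\ is_URS A /\ A `<=` stability_system Xt,
        forall B, is_URS B -> B `<=` stability_system Xt -> B = A,
        amenable_URS R A,
        urs_le A (stability_system X) &
        forall U, amenable_URS R U -> urs_le U (stability_system X) ->
          urs_le U A].
Proof.
have amen B : is_URS B -> B `<=` stability_system Xt -> amenable_URS R B.
  move=> uB BS; split=> // H /BS/stability_system_below_stab[y Hy].
  exact: amenable_sub_stab Xt_envelope _ _ Hy.
have le_SX B : is_URS B -> B `<=` stability_system Xt ->
    urs_le B (stability_system X).
  move=> [[_ [H BH] _] _] BS.
  have [_ [y gy <-]|L [SL HL]] :=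
    closure_has_sup (closed_stability_system (X := X))
      (S := [set stab y | y in [set y : Xt | stab y = stab0 y]]) _ (BS _ BH).
    exact: generic_stab_below Xt_envelope _ G_countable gy.
  by exists H, L.
have largest U B : amenable_URS R U -> urs_le U (stability_system X) ->
    is_URS B -> B `<=` stability_system Xt -> urs_le U B.
  move=> aU US [[_ [K BK] _] _] BS.
  have [[[cU _ _] _] _] := aU.
  have [_ [y _ <-]|H [UH HK]] := closure_has_sub cU
      (S := [set stab y | y in [set y : Xt | stab y = stab0 y]]) _ (BS _ BK).
    exact: amenable_URS_below_stab Xt_envelope _ _ G_countable aU SX_urs US.
  by exists H, K.
have [A uA AS] :=
  closed_invariant_has_URS (stability_system_closed_invariant Xt G_countable).
exists A; split; [by []| |exact: amen|exact: le_SX|].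
- move=> B uB BS; apply: urs_le_anti => //.
  + by apply: largest (AS) => //; [exact: amen|exact: le_SX].
  + by apply: largest (BS) => //; [exact: amen|exact: le_SX].
- by move=> U aU US; exact: largest.
Qed.
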